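(* The elementary embeddability relation $\preccurlyeq_{\mathfrak G}$ on the space $\mathfrak G$ of countable graphs (with universe $\omega$) is a complete $\boldsymbol{\Sigma}^1_1$ quasi-order with respect to Borel reducibility: every $\boldsymbol{\Sigma}^1_1$ quasi-order on a Polish space is Borel reducible to $\preccurlyeq_{\mathfrak G}$. In particular, the elementary bi-embeddability relation $\approxeq_{\mathfrak G}$ on graphs is a complete $\boldsymbol{\Sigma}^1_1$ equivalence relation: every $\boldsymbol{\Sigma}^1_1$ equivalence relation on a Polish space is Borel reducible to $\approxeq_{\mathfrak G}$.
   Context: Countable structures in a relational language have universe $\omega$. Each such structure is identified with an element of the compact Polish space $\prod_i 2^{\omega^{a_i}}$ (one factor per relation symbol $R_i$ of arity $a_i$), and $\mathfrak G$ is the (Borel) subspace of graphs. $\mathcal A\preccurlyeq\mathcal B$ means $\mathcal A$ is elementarily embeddable in $\mathcal B$; $\mathcal A\approxeq\mathcal B$ means $\mathcal A\preccurlyeq\mathcal B$ and $\mathcal B\preccurlyeq\mathcal A$. A relation $R$ on $X$ is Borel reducible to a relation $S$ on $Y$ if there is a Borel map $f:X\to Y$ with $x\,R\,y \iff f(x)\,S\,f(y)$ for all $x,y$. *)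

(* Defs.v *)
From mathcomp Require Import all_boot all_order all_algebra.
From mathcomp Require Import boolp classical_sets functions cardinality topology measure.
From Stdlib Require Import Rdefinitions.

Set Implicit Arguments.
Unset Strict Implicit.
Unset Printing Implicit Defensive.

Local Open Scope classical_set_scope.

Definition compatible_complete_metric (T : topologicalType)
    (d : T -> T -> Rdefinitions.R) : Prop :=
  [/\ (forall x y, d x y = Rdefinitions.R0 <-> x = y),
      (forall x y, d x y = d y x),
      (forall x y z, Rdefinitions.Rle (d x z) (Rdefinitions.Rplus (d x y) (d y z))),
      (forall A : set T, open A <->
          (forall x, A x -> exists e, Rdefinitions.Rlt Rdefinitions.R0 e /\
                      (forall y, Rdefinitions.Rlt (d x y) e -> A y))) &
      (forall u : nat -> T,
          (forall e, Rdefinitions.Rlt Rdefinitions.R0 e ->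
             exists N, forall m n, (N <= m)%N -> (N <= n)%N ->
               Rdefinitions.Rlt (d (u m) (u n)) e) ->
          exists l, forall e, Rdefinitions.Rlt Rdefinitions.R0 e ->
             exists N, forall n, (N <= n)%N -> Rdefinitions.Rlt (d (u n) l) e)].

Definition separable_space (T : topologicalType) : Prop :=
  exists D : set T, countable D /\ closure D = setT.

Definition polish (T : topologicalType) : Prop :=
  separable_space T /\ exists d, @compatible_complete_metric T d.

Definition borel (T : topologicalType) : set (set T) :=
  smallest (sigma_algebra setT) (@open T).

Definition borel_fun (T U : topologicalType) (f : T -> U) : Prop :=
  forall B : set U, borel B -> borel (f @^-1` B).

(* Sigma^1_1 (analytic): continuous image of a Polish space
   (the empty set is the image of the empty Polish space). *)
Definition analytic (X : topologicalType) (A : set X) : Prop :=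
  exists (Y : topologicalType) (f : Y -> X),
    [/\ polish Y, continuous f & f @` setT = A].

Definition quasi_order (X : Type) (R : X -> X -> Prop) : Prop :=
  (forall x, R x x) /\ (forall x y z, R x y -> R y z -> R x z).

Definition equivalence_rel (X : Type) (R : X -> X -> Prop) : Prop :=
  quasi_order R /\ (forall x y, R x y -> R y x).

Definition sigma11_quasi_order (X : topologicalType) (R : X -> X -> Prop) : Prop :=
  quasi_order R /\ analytic [set p : X * X | R p.1 p.2].

Definition sigma11_equivalence (X : topologicalType) (R : X -> X -> Prop) : Prop :=
  equivalence_rel R /\ analytic [set p : X * X | R p.1 p.2].

(* structures in the language {E} with universe omega: elements of 2^(omega x omega)
   with the product topology *)
Definition graph_code : topologicalType := prod_topology (fun _ : nat * nat => bool).

Definition is_graph (G : graph_code) : Prop :=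
  (forall i, G (i, i) = false) /\ (forall i j, G (i, j) = G (j, i)).

Inductive gformula : Type :=
  | GEq of nat & nat
  | GEdge of nat & nat
  | GNot of gformula
  | GAnd of gformula & gformula
  | GEx of nat & gformula.

Fixpoint gsat (G : graph_code) (s : nat -> nat) (phi : gformula) : Prop :=
  match phi with
  | GEq i j => s i = s j
  | GEdge i j => G (s i, s j) = true
  | GNot p => ~ gsat G s p
  | GAnd p q => gsat G s p /\ gsat G s q
  | GEx i p => exists a : nat, gsat G (fun k => if k == i then a else s k) p
  end.

Definition elementary_embedding (G H : graph_code) (h : nat -> nat) : Prop :=
  forall (phi : gformula) (s : nat -> nat), gsat G s phi <-> gsat H (h \o s) phi.

Definition elem_embeddable (G H : graph_code) : Prop :=
  exists h : nat -> nat, elementary_embedding G H h.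

Definition elem_biembeddable (G H : graph_code) : Prop :=
  elem_embeddable G H /\ elem_embeddable H G.

Definition on_graphs (S : graph_code -> graph_code -> Prop) : set (graph_code * graph_code) :=
  [set p | [/\ is_graph p.1, is_graph p.2 & S p.1 p.2]].

Definition borel_reducible_to_graphs (X : topologicalType) (R : X -> X -> Prop)
    (S : graph_code -> graph_code -> Prop) : Prop :=
  exists f : X -> graph_code,
    [/\ borel_fun f, (forall x, is_graph (f x)) &
        (forall x y, R x y <-> S (f x) (f y))].

(* Main.v *)
(** A [Sigma^1_1] quasi-order [R] on a Polish space is the image of a Polish space [Y]
under a continuous map. Coding points by the basic open sets containing them, and points
of [Y] by sequences of small balls, one step [x R y] is witnessed by an infinite sequence
of natural numbers. Bundling a whole chain [x R ... R y], levelwise, into a sequence of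
words makes witnesses compose by levelwise concatenation: [x R y] iff there is a
sequence [al] of words with [T n x y al] for all [n], where [T n] looks at finitely many
bits and [T n x y al] and [T n y z be] imply [T n x z (al ++ be)]. Label a node [s] of
the tree of finite sequences of words with all codes [u] such that [T |s| u x s]. By
transitivity the injection [s |-> s ++ al] can only enlarge labels when [al] witnesses
[x R y]; conversely, any tree embedding enlarging labels sends the branch of empty words
to a witness, by reflexivity.

The labelled tree becomes a graph in the spirit of Marker extensions: each node carries
infinitely many stars of every finite size for every potential label [u], and infinite
stars if [u] is really a label. A formula with [N] variables cannot tell an infinite star
from one with at least [N] rays, so up to [N]-variable equivalence all labels look the
same and label-enlarging maps are elementary. Conversely elementary maps preserve the
numbers of common neighbours, which encode the kind of each link, the level of a node,
the name of a label, and the size of a star.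

Analyticity: an elementary embedding together with both satisfaction relations and
Skolem witnesses is a point of a closed subset of the Baire space. *)

From Stdlib Require Import Reals Lra.
Require Import Defs.
From HB Require Import structures.
From mathcomp Require Import all_boot all_order all_algebra.
From mathcomp Require Import zify.
From mathcomp Require Import boolp classical_sets functions cardinality topology measure.

Set Implicit Arguments.
Unset Strict Implicit.
Unset Printing Implicit Defensive.

(** * Pebble games *)

Fixpoint vars_below (N : nat) (phi : gformula) : bool :=
  match phi with
  | GEq i j => (i < N) && (j < N)
  | GEdge i j => (i < N) && (j < N)
  | GNot p => vars_below N p
  | GAnd p q => vars_below N p && vars_below N q
  | GEx i p => (i < N) && vars_below N p
  end.

Lemma vars_below_leq M N phi : M <= N -> vars_below M phi -> vars_below N phi.
Proof.
move=> MN; elim: phi => [i j|i j|p IH|p IHp q IHq|i p IH] //=.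
- by move=> /andP[/leq_trans-> // /leq_trans->].
- by move=> /andP[/leq_trans-> // /leq_trans->].
- by move=> /andP[/IHp-> /IHq->].
- by move=> /andP[/leq_trans-> // /IH->].
Qed.

Lemma vars_below_exists phi : exists N, vars_below N phi.
Proof.
elim: phi => [i j|i j|p IH|p [M Mp] q [N Nq]|i p [N Np]] //=.
- by exists (maxn i j).+1; rewrite !ltnS leq_maxl leq_maxr.
- by exists (maxn i j).+1; rewrite !ltnS leq_maxl leq_maxr.
- exists (maxn M N); rewrite (vars_below_leq (leq_maxl M N) Mp).
  by rewrite (vars_below_leq (leq_maxr M N) Nq).
- exists (maxn i.+1 N); rewrite (vars_below_leq (leq_maxr _ N) Np) andbT.
  by rewrite leq_max ltnSn.
Qed.

Lemma gsat_ext G N phi s t : vars_below N phi ->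
  (forall i, i < N -> s i = t i) -> gsat G s phi <-> gsat G t phi.
Proof.
elim: phi s t => [i j|i j|p IH|p IHp q IHq|i p IH] s t /=.
- by move=> /andP[iN jN] st; rewrite !st.
- by move=> /andP[iN jN] st; rewrite !st.
- by move=> pN st; rewrite (IH s t).
- by move=> /andP[pN qN] st; rewrite (IHp s t) // (IHq s t).
- move=> /andP[_ pN] st; split=> -[a] H; exists a; move: H.
    by rewrite (IH _ (fun k => if k == i then a else t k)) // => j jN; rewrite st.
  by rewrite (IH (fun k => if k == i then a else s k)
    (fun k => if k == i then a else t k)) // => j jN; rewrite st.
Qed.

Section Pebbles.
Variables (G H : graph_code) (N : nat) (rho : nat -> nat -> Prop).

Definition pebble_match (p : seq (nat * nat)) : Prop :=
  (forall q, q \in p -> rho q.1 q.2) /\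
  (forall q r, q \in p -> r \in p -> q.1 = r.1 <-> q.2 = r.2).

Hypothesis rho_edge : forall a a' b b', rho a a' -> rho b b' -> G (a, b) = H (a', b').
Hypothesis forth : forall p a, size p < N -> pebble_match p ->
  exists a', pebble_match ((a, a') :: p).
Hypothesis back : forall p a', size p < N -> pebble_match p ->
  exists a, pebble_match ((a, a') :: p).

(** In the [GEx] case the pair of the requantified variable is removed first, so that fewer than [N]
    pairs remain and a new one may be placed. *)
Lemma pebble_equiv phi s t : vars_below N phi ->
  pebble_match [seq (s i, t i) | i <- iota 0 N] -> gsat G s phi <-> gsat H t phi.
Proof.
elim: phi s t => [i j|i j|p IH|p IHp q IHq|i p IH] s t /=.
- move=> /andP[iN jN] [_ /(_ (s i, t i) (s j, t j))] /= ->//; apply/mapP.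
    by exists i; rewrite ?mem_iota.
  by exists j; rewrite ?mem_iota.
- move=> /andP[iN jN] [/[dup] r1 + _] => /(_ (s i, t i)) /= ri.
  have -> // : G (s i, s j) = H (t i, t j).
  apply: rho_edge; first by apply: ri; apply/mapP; exists i; rewrite ?mem_iota.
  by apply: (r1 (s j, t j)); apply/mapP; exists j; rewrite ?mem_iota.
- by move=> pN st; rewrite (IH s t).
- by move=> /andP[pN qN] st; rewrite (IHp s t) // (IHq s t).
move=> /andP[iN pN] [m1 m2].
pose P := [seq (s j, t j) | j <- iota 0 N & j != i].
have szP : size P < N.
  rewrite size_map size_filter -[X in _ < X](size_iota 0 N).
  rewrite -(count_predC (fun j => j != i) (iota 0 N)) -[X in X < _]addn0 ltn_add2l.
  rewrite -has_count; apply/hasP; exists i; rewrite ?mem_iota //=.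
  by rewrite negbK.
have sub q : q \in P -> q \in [seq (s j, t j) | j <- iota 0 N].
  by case/mapP=> j; rewrite mem_filter => /andP[_ jN ->]; apply/mapP; exists j.
have mP : pebble_match P.
  by split=> [q /sub/m1|q r /sub qP /sub rP] //; apply: m2.
have upd a a' : pebble_match ((a, a') :: P) ->
    pebble_match [seq ((if k == i then a else s k), (if k == i then a' else t k))
                 | k <- iota 0 N].
  move=> [n1 n2]; have sub' q : q \in [seq ((if k == i then a else s k),
      (if k == i then a' else t k)) | k <- iota 0 N] -> q \in (a, a') :: P.
    case/mapP => j jN ->; case: eqP => [ji|/eqP ji]; rewrite in_cons ?eqxx //.
    by apply/orP; right; apply/mapP; exists j; rewrite // mem_filter ji.
  by split=> [q /sub'/n1|q r /sub' qP /sub' rP] //; apply: n2.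
split=> -[a pa].
  have [a' aa'] := forth a szP mP; exists a'.
  by apply/(IH _ _ pN (upd _ _ aa')).
have [a' aa'] := back a szP mP; exists a'.
by apply/(IH _ _ pN (upd _ _ aa')).
Qed.

End Pebbles.

Lemma seq_exists_notin (T : eqType) (s t : seq T) :
  uniq s -> size t < size s -> exists2 x, x \in s & x \notin t.
Proof.
move=> us; rewrite ltnNge => ts; apply/hasP; apply: contraNT ts => /hasPn st.
by apply: uniq_leq_size => // x /st; rewrite negbK.
Qed.

(** If [a] is already pebbled, its partner is reused. Otherwise [a] and the pebbled points of its
    colour are at most [N] points of one fibre; the matching fibre has as many points, hence one
    still free. *)
Lemma pebble_extend (C : eqType) (cG cH : nat -> C) (Phi : C -> C) (N : nat)
    (p : seq (nat * nat)) (a : nat) :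
  injective Phi ->
  (forall c l, uniq l -> size l <= N -> {in l, forall v, cG v = c} ->
     exists l', [/\ uniq l', size l' = size l & {in l', forall v, cH v = Phi c}]) ->
  size p < N -> pebble_match (fun a a' => cH a' = Phi (cG a)) p ->
  exists a', pebble_match (fun a a' => cH a' = Phi (cG a)) ((a, a') :: p).
Proof.
move=> injPhi fib szp [m1 m2].
suff [a' aa' Ha'] : exists2 a', cH a' = Phi (cG a) &
    forall q, q \in p -> q.1 = a <-> q.2 = a'.
  exists a'; split=> [q|q r]; rewrite !inE.
    by case/predU1P=> [->|/m1].
  case/predU1P=> [->|qp]; case/predU1P=> [->|rp] //=.
  - by split=> /esym/Ha' /= => /(_ rp) ->.
  - exact: Ha'.
  - exact: m2.
have [|/hasPn nop] := boolP (has (fun q => q.1 == a) p).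
  case/hasP=> q qp /eqP qa; exists q.2; first by rewrite -qa; apply: m1.
  by move=> r rp; rewrite -qa; apply: m2.
pose p' := undup [seq q <- p | cG q.1 == cG a].
have p'P q : q \in p' -> (q \in p) /\ cG q.1 = cG a.
  by rewrite mem_undup mem_filter => /andP[/eqP].
have sp' : size p' <= size p.
  by rewrite (leq_trans (size_undup _)) // size_filter count_size.
have u1 : uniq (a :: map fst p').
  rewrite /= map_inj_in_uniq ?undup_uniq ?andbT.
    by apply/mapP=> -[q /p'P[qp _] aq]; have := nop _ qp; rewrite /= aq eqxx.
  move=> [q1 q2] [r1 r2] /p'P[qp _] /p'P[rp _] /= E.
  by have := m2 _ _ qp rp; rewrite /= E => -[/(_ erefl) -> _].
have [| |l' [ul' sl' cl']] := fib (cG a) _ u1.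
- by rewrite /= size_map; apply: leq_trans szp.
- by move=> v; rewrite inE => /predU1P[->//|/mapP[q /p'P[_ qa] ->]].
have [|a' a'l na'] := @seq_exists_notin _ l' (map snd p') ul'.
  by rewrite sl' /= !size_map.
exists a'; first exact: cl'.
move=> q qp; split=> [qa|qa'].
  by have := nop _ qp; rewrite qa eqxx.
case/negP: na'; apply/mapP; exists q => //.
rewrite mem_undup mem_filter qp andbT; apply/eqP/injPhi.
by rewrite -m1 // qa' cl'.
Qed.

(* Each formula with [N] variables cannot count beyond [N]: a bijection of colours
   matching the sizes of the fibres up to [N] is enough to play forever. *)
Lemma colour_equiv (C : eqType) (cG cH : nat -> C) (Phi Psi : C -> C) (N : nat)
    (G H : graph_code) phi s t :
  cancel Phi Psi -> cancel Psi Phi ->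
  (forall a a' b b', cH a' = Phi (cG a) -> cH b' = Phi (cG b) ->
     G (a, b) = H (a', b')) ->
  (forall c l, uniq l -> size l <= N -> {in l, forall v, cG v = c} ->
     exists l', [/\ uniq l', size l' = size l & {in l', forall v, cH v = Phi c}]) ->
  (forall c l, uniq l -> size l <= N -> {in l, forall v, cH v = c} ->
     exists l', [/\ uniq l', size l' = size l & {in l', forall v, cG v = Psi c}]) ->
  vars_below N phi ->
  (forall i, i < N -> cH (t i) = Phi (cG (s i))) ->
  (forall i j, i < N -> j < N -> s i = s j <-> t i = t j) ->
  gsat G s phi <-> gsat H t phi.
Proof.
move=> PK QK edge fibG fibH phiN st1 st2.
apply: (@pebble_equiv G H N (fun a a' => cH a' = Phi (cG a))) => //.
- by move=> p a sp mp; apply: pebble_extend fibG sp mp; apply: can_inj PK.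
(* The back move is the forth move with the two sides swapped and [Psi] in place of [Phi]. *)
- move=> p a' sp [m1 m2].
  have flip q : cG q.1 = Psi (cH q.2) <-> cH q.2 = Phi (cG q.1).
    by split=> [->|->]; rewrite ?PK ?QK.
  pose sw (q : nat * nat) := (q.2, q.1).
  have swP q l : (q \in map sw l) = (sw q \in l).
    by rewrite -[q in LHS](_ : sw (sw q) = q) ?mem_map //; [move=> [? ?] [? ?] [-> ->]|case: q].
  have [| |a [n1 n2]] := @pebble_extend C cH cG Psi N (map sw p) a' (can_inj QK) fibH.
  + by rewrite size_map.
  + split=> [q|q r]; rewrite !swP => qp; first by have /flip := m1 _ qp.
    by move=> rp; have [] := m2 _ _ qp rp.
  exists a; have inP q : q \in (a, a') :: p -> sw q \in (a', a) :: map sw p.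
    by rewrite !inE swP; case: q => x y /=; rewrite !xpair_eqE andbC.
  split=> [q /inP/n1/=|q r /inP qp /inP rp]; last by have [] := n2 _ _ qp rp.
  exact: (flip q).1.
- split=> [q /mapP[i]|q r /mapP[i + ->] /mapP[j + ->]]; rewrite ?mem_iota //=.
    by move=> iN ->; apply: st1.
  exact: st2.
Qed.

(** * Levelwise composition of witnesses *)

(** A formula meets only finitely many words, so this lets a bijection of words stand in for the
    injection [w ++ al l]. *)
Lemma bijection_extend (T : eqType) (f : T -> T) (l : seq T) : injective f ->
  exists g g', [/\ cancel g g', cancel g' g & {in l, g =1 f}].
Proof.
move=> injf; elim: l => [|x l [g [g' [gK g'K gf]]]]; first by exists id, id; split.
have [xl|xl] := boolP (x \in l).
  by exists g, g'; split=> // y; rewrite inE => /predU1P[->|]; apply: gf.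
(* The transposition of [g x] and [f x] corrects the value at [x]; as [f] and [g] are injective, it
   moves no value taken on [l]. *)
pose sw y := if y == g x then f x else if y == f x then g x else y.
have swK : involutive sw.
  move=> y; rewrite /sw; have [->|ygx] := eqVneq y (g x).
    by rewrite eqxx; case: eqP => // ->.
  have [->|yfx] := eqVneq y (f x); first by rewrite eqxx.
  by rewrite (negPf ygx) (negPf yfx).
exists (sw \o g), (g' \o sw); split.
- by move=> y /=; rewrite swK gK.
- by move=> y /=; rewrite g'K swK.
move=> y; rewrite inE /sw /=; case: (eqVneq y x) => [->|yx] /= yl; first by rewrite eqxx.
rewrite (inj_eq (can_inj gK)) (negPf yx) gf // (inj_eq injf) (negPf yx) //.
Qed.

Notation word := (seq (nat * bool)).

(* A node of the tree of finite sequences of words is listed from its last level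
   down to level 0, so that [behead] is the parent map. *)
Definition level (s : seq word) (l : nat) : word := nth [::] (rev s) l.

Fixpoint levelwise (f : nat -> word -> word) (s : seq word) : seq word :=
  if s is w :: s' then f (size s') w :: levelwise f s' else [::].

Lemma size_levelwise f s : size (levelwise f s) = size s.
Proof. by elim: s => //= w s ->. Qed.

Lemma levelwise_behead f s : levelwise f (behead s) = behead (levelwise f s).
Proof. by case: s. Qed.

Lemma levelwiseK f g : (forall l, cancel (f l) (g l)) ->
  cancel (levelwise f) (levelwise g).
Proof. by move=> fK; elim=> //= w s ->; rewrite size_levelwise fK. Qed.

Lemma levelwise_inj f : (forall l, injective (f l)) -> injective (levelwise f).
Proof.
move=> injf; elim=> [|w s IH] [|w' s'] //= [+ /[dup] E /IH ss]; rewrite ss.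
by move/injf ->.
Qed.

Lemma levelwise_level f g s : (forall l, l < size s -> f l (level s l) = g l (level s l)) ->
  levelwise f s = levelwise g s.
Proof.
rewrite /level; elim: s => //= w s IH E; congr (_ :: _).
  by have := E (size s) (ltnSn _); rewrite rev_cons nth_rcons size_rev ltnn eqxx.
apply: IH => l ls; have := E l (leqW ls).
by rewrite rev_cons nth_rcons size_rev ls.
Qed.

Lemma level_levelwise f s l : l < size s -> level (levelwise f s) l = f l (level s l).
Proof.
rewrite /level; elim: s => //= w s IH; rewrite ltnS !rev_cons !nth_rcons !size_rev.
rewrite size_levelwise leq_eqVlt => /predU1P[->|ls]; last by rewrite ls IH.
by rewrite ltnn eqxx.
Qed.

Lemma level_nseq n l : level (nseq n [::]) l = [::].
Proof. by rewrite /level rev_nseq nth_nseq if_same. Qed.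

(** * Chains of steps and the labels they define *)

Section Chains.
Variable step : nat -> (nat -> bool) -> (nat -> bool) -> (nat -> nat) -> Prop.

(* The columns of the words [al 0], ..., [al n.-1], all of length [k], spell out a
   sequence of [k] steps from [u] to [v] together with the witnesses. *)
Fixpoint chain (n k : nat) (u v : nat -> bool) (al : nat -> word) : Prop :=
  if k is k'.+1 then
    [/\ forall l, l < n -> al l != [::],
        step n u (fun l => (head (0, false) (al l)).2) (fun l => (head (0, false) (al l)).1) &
        chain n k' (fun l => (head (0, false) (al l)).2) v (fun l => behead (al l))]
  else forall l, l < n -> u l = v l /\ al l = [::].

Hypothesis step_ext : forall n u u' v v' a a',
  (forall l, l < n -> [/\ u l = u' l, v l = v' l & a l = a' l]) ->
  step n u v a -> step n u' v' a'.

Lemma chain_ext n k u u' v v' al al' :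
  (forall l, l < n -> [/\ u l = u' l, v l = v' l & al l = al' l]) ->
  chain n k u v al -> chain n k u' v' al'.
Proof.
elim: k u u' v v' al al' => [|k IH] u u' v v' al al' E /=.
  by move=> H l ln; have [<- <- <-] := E l ln; apply: H.
move=> [ne st ch]; split.
- by move=> l ln; have [_ _ <-] := E l ln; apply: ne.
- by apply: step_ext st => l ln; have [-> _ ->] := E l ln.
- by apply: IH ch => l ln; have [_ -> ->] := E l ln.
Qed.

Hypothesis step_restrict : forall m n u v a, m <= n -> step n u v a -> step m u v a.

Lemma chain_restrict m n k u v al : m <= n -> chain n k u v al -> chain m k u v al.
Proof.
move=> mn; elim: k u al => [|k IH] u al /=; first by move=> H l lm; apply: H; apply: leq_trans mn.
move=> [ne st ch]; split; first by move=> l lm; apply: ne; apply: leq_trans mn.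
  exact: step_restrict st.
exact: IH.
Qed.

Lemma chain_cat n k k' u v w al be : chain n k u v al -> chain n k' v w be ->
  chain n (k + k') u w (fun l => al l ++ be l).
Proof.
elim: k u al => [|k IH] u al /=.
  move=> uv; apply: chain_ext => l /uv[-> ->]; split=> //.
move=> [ne st ch] ch'.
have hd l : l < n -> head (0, false) (al l ++ be l) = head (0, false) (al l).
  by move/ne; case: (al l).
split.
- by move=> l /ne; case: (al l).
- by apply: step_ext st => l /hd->.
- apply: chain_ext (IH _ _ ch ch') => l ln.
  by rewrite hd //; split=> //; move: (ne l ln); case: (al l).
Qed.

(** For positive [n] the words determine the number of steps. Hence the [k] hidden in [linked]
    cannot vary with [n]. *)
Lemma chain_size n k u v al : chain n k u v al -> forall l, l < n -> size (al l) = k.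
Proof.
elim: k u al => [|k IH] u al /=; first by move=> H l /H[_ ->].
move=> [ne _ ch] l ln; have := IH _ _ ch l ln; rewrite size_behead => <-.
by rewrite prednK // lt0n size_eq0 ne.
Qed.

Definition linked (n : nat) (u v : nat -> bool) (al : nat -> word) : Prop :=
  exists k, chain n k u v al.

Lemma linked_ext n u u' v v' al al' :
  (forall l, l < n -> [/\ u l = u' l, v l = v' l & al l = al' l]) ->
  linked n u v al -> linked n u' v' al'.
Proof. by move=> E [k ch]; exists k; apply: chain_ext ch. Qed.

Definition label (x : nat -> bool) (s : seq word) (u : seq bool) : bool :=
  `[< size u = size s /\ linked (size s) (nth false u) x (level s) >].

Lemma label_ext x y s u : (forall l, l < size s -> x l = y l) ->
  label x s u = label y s u.
Proof.
move=> xy; apply/asboolP/asboolP => -[us lk]; split=> //;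
  by apply: linked_ext lk => l ls; rewrite xy.
Qed.

Lemma label_refl x n : label x (nseq n [::]) (mkseq x n).
Proof.
apply/asboolP; rewrite size_mkseq size_nseq; split=> //; exists 0 => l ln.
by rewrite nth_mkseq // level_nseq.
Qed.

(** Transitivity: the chain ending in [x] is prolonged by the one from [x] to [y], level by
    level. *)
Lemma label_shift x y al : (forall n, linked n x y al) -> forall s u,
  label x s u -> label y (levelwise (fun l w => w ++ al l) s) u.
Proof.
move=> xy s u /asboolP[us [k ch]]; apply/asboolP; rewrite size_levelwise; split=> //.
have [k' ch'] := xy (size s); exists (k + k').
by apply: chain_ext (chain_cat ch ch') => l ls; rewrite level_levelwise.
Qed.

(** The nodes [be n] lie on one branch, whose word at level [l] is the last one of [be l.+1]; the
    labels along it say that this branch links [x] to [y]. *)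
Lemma linked_branch x y (be : nat -> seq word) :
  (forall n, size (be n) = n) -> (forall n, behead (be n.+1) = be n) ->
  (forall n, label y (be n) (mkseq x n)) ->
  exists al, forall n, linked n x y al.
Proof.
move=> sz bh lab; exists (fun l => level (be l.+1) l) => n.
have /asboolP[_] := lab n; rewrite sz; apply: linked_ext => l ln.
split=> //; first by rewrite nth_mkseq.
elim: n ln {lab} => // n IH; rewrite ltnS leq_eqVlt => /predU1P[->//|ln].
rewrite -IH // -(bh n) /level; have := sz n.+1; case: (be n.+1) => // w s [sn].
by rewrite [behead _]/= rev_cons nth_rcons size_rev sn ln.
Qed.

End Chains.

(** * Star graphs and their elementary embeddings *)

(** In [(u, (m, k), b)], [u] is the label, [m] the row and [k] the number of the copy. The hub is
    the centre if [b] is [false]; if [b] is [true] it is a dummy end, and the rays of the star are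
    the link vertices between it and the centre. *)
Notation star := (seq bool * (nat * nat) * bool)%type.
Notation hub := (seq word * option star)%type.

Definition parent (t : hub) : hub :=
  match t.2 with
  | None => (behead t.1, None)
  | Some (i, true) => (t.1, Some (i, false))
  | Some (i, false) => (t.1, None)
  end.

(** The absence of 2-cycles means that a link is determined by its two ends. *)
Lemma parent_parent t : parent (parent t) = t -> parent t = t.
Proof.
case: t => [s [[[u i] [|]]|]] //= [E]; suff -> : s = [::] by [].
by apply: size0nil; move/(congr1 size): E; rewrite !size_behead; lia.
Qed.

(* Sizes of the stars of label [u] at [s]: all finite sizes, and also the infinite
   size (in row 0) when the label is present. *)
Definition row (lab : seq word -> seq bool -> bool) s u m : option nat :=
  if lab s u then (if m is m'.+1 then Some m' else None) else Some m.

(* The residue modulo 3 of a weight tells which kind of link carries it; [None] is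
   the infinite weight. *)
Definition weight lab (t : hub) : option nat :=
  match t.2 with
  | None => Some (3 * size t.1)
  | Some (i, false) => Some (3 * pickle i.1 + 4)
  | Some (i, true) => omap (fun m => 3 * m + 5) (row lab t.1 i.1 i.2.1)
  end.

Definition in_mult (i : nat) (w : option nat) : bool := if w is Some m then i < m else true.

(* A colour is a hub, or the link (Boolean [true]) between a hub and its parent. *)
Notation colour := (hub * bool)%type.

Definition mult lab (c : colour) : option nat := if c.2 then weight lab c.1 else Some 1.

Definition colour_of lab (v : nat) : option colour :=
  if @pickle_inv (colour * nat)%type v is Some (c, i) then
    if in_mult i (mult lab c) then Some c else None
  else None.

Definition vertex (c : colour) (i : nat) : nat := pickle (c, i).

Lemma colour_vertex lab c i :
  colour_of lab (vertex c i) = if in_mult i (mult lab c) then Some c else None.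
Proof. by rewrite /colour_of /vertex pickleK_inv. Qed.

Lemma vertex_inj c i c' i' : vertex c i = vertex c' i' -> (c, i) = (c', i').
Proof. by move/(pcan_inj (@pickleK _)). Qed.

Lemma colour_someP lab v c : colour_of lab v = Some c ->
  exists2 i, v = vertex c i & in_mult i (mult lab c).
Proof.
rewrite /colour_of; case E : pickle_inv => [[c' i]|] //; case: ifP => // ci [<-].
by exists i => //; have := @pickle_invK (colour * nat)%type v; rewrite E /= => <-.
Qed.

Lemma fibre_size lab c l : uniq l -> {in l, forall v, colour_of lab v = Some c} ->
  forall i, i < size l -> in_mult i (mult lab c).
Proof.
move=> ul cl i il; case E : (mult lab c) => [m|] //=; apply: leq_trans il _.
rewrite -(size_iota 0 m) -(size_map (vertex c)); apply: uniq_leq_size => // v /cl.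
case/colour_someP => j -> jm; apply/mapP; exists j => //.
by rewrite mem_iota; move: jm; rewrite E.
Qed.

Lemma hub_unique lab t v w : colour_of lab v = Some (t, false) ->
  colour_of lab w = Some (t, false) -> v = w.
Proof. by move=> /colour_someP[[|//] -> _] /colour_someP[[|//] -> _]. Qed.

Definition incident (t l : hub) : bool := (t == l) || (t == parent l).

Definition adjacent (c c' : option colour) : bool :=
  match c, c' with
  | Some (t, b), Some (t', b') =>
      if b then ~~ b' && incident t' t else b' && incident t t'
  | _, _ => false
  end.

Definition star_graph lab : graph_code :=
  fun p => adjacent (colour_of lab p.1) (colour_of lab p.2).

Lemma star_graph_is_graph lab : is_graph (star_graph lab).
Proof.
split=> [i|i j]; rewrite /star_graph /=.
  by case: colour_of => [[t []]|].
by case: (colour_of lab i) => [[t []]|]; case: (colour_of lab j) => [[t' []]|].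
Qed.

Definition hub_map (sg : seq word -> seq word)
    (f : seq word -> seq bool -> nat * nat -> nat * nat) (t : hub) : hub :=
  (sg t.1, omap (fun p : star => (p.1.1, f t.1 p.1.1 p.1.2, p.2)) t.2).

Definition colour_map sg f : option colour -> option colour :=
  omap (fun c : colour => (hub_map sg f c.1, c.2)).

Lemma hub_map_parent sg f t : (forall s, sg (behead s) = behead (sg s)) ->
  hub_map sg f (parent t) = parent (hub_map sg f t).
Proof. by move=> sgb; case: t => [s [[[u i] []]|]] //=; rewrite /hub_map /= sgb. Qed.

Lemma hub_mapK sg f sg' f' : cancel sg sg' ->
  (forall s u, cancel (f s u) (f' (sg s) u)) -> cancel (hub_map sg f) (hub_map sg' f').
Proof. by move=> sK fK [s [[[u i] b]|]]; rewrite /hub_map /= sK ?fK. Qed.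

Lemma hub_map_inj sg f : injective sg -> (forall s u, injective (f s u)) ->
  injective (hub_map sg f).
Proof.
move=> si fi [s [[[u i] b]|]] [s' [[[u' i'] b']|]] //= [/si ss]; rewrite ss //.
by move=> uu ff bb; move: ff; rewrite -uu => /fi ->; rewrite bb.
Qed.

Lemma colour_mapK sg f sg' f' : cancel sg sg' ->
  (forall s u, cancel (f s u) (f' (sg s) u)) ->
  cancel (colour_map sg f) (colour_map sg' f').
Proof. by move=> sK fK [[t b]|] //=; rewrite (hub_mapK sK fK). Qed.

Lemma adjacent_map sg f c c' : (forall s, sg (behead s) = behead (sg s)) ->
  injective (hub_map sg f) ->
  adjacent (colour_map sg f c) (colour_map sg f c') = adjacent c c'.
Proof.
move=> sgb inj; case: c c' => [[t b]|] [[t' b']|] //=.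
by rewrite /incident -!hub_map_parent // !(inj_eq inj).
Qed.

Lemma fibre_transfer labx laby sg f N c l :
  (forall t i, i < N -> in_mult i (weight labx t) -> in_mult i (weight laby (hub_map sg f t))) ->
  uniq l -> size l <= N -> {in l, forall v, colour_of labx v = c} ->
  exists l', [/\ uniq l', size l' = size l &
    {in l', forall v, colour_of laby v = colour_map sg f c}].
Proof.
move=> sim ul lN; case: c => [[t b]|] cl.
  exists [seq vertex (hub_map sg f t, b) i | i <- iota 0 (size l)].
  rewrite size_map size_iota map_inj_uniq ?iota_uniq; last by move=> i j /vertex_inj[].
  split=> // v /mapP[i]; rewrite mem_iota => /= il ->; rewrite colour_vertex.
  have := fibre_size ul cl il; rewrite /mult /=; case: b {cl} => [|->] //.
  by move=> /sim-> //; apply: leq_trans lN.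
(* A hub has multiplicity one, so its copies of positive index are uncoloured; they supply
   infinitely many vertices of colour [None]. *)
exists [seq vertex (([::], None), false) i.+1 | i <- iota 0 (size l)].
rewrite size_map size_iota map_inj_uniq ?iota_uniq; last by move=> i j /vertex_inj[].
by split=> // v /mapP[i _ ->]; rewrite colour_vertex.
Qed.

(* Hilbert's hotel: rows below [N] move up by one, and row [N] (too long to be told
   apart from an infinite one) is split between rows [0] and [N.+1]. *)
Definition hotel (N : nat) (i : nat * nat) : nat * nat :=
  if i.1 == N then (if odd i.2 then N.+1 else 0, i.2./2) else (i.1.+1, i.2).

Definition hotel_inv (N : nat) (i : nat * nat) : nat * nat :=
  if i.1 == 0 then (N, i.2.*2) else
  if i.1 == N.+1 then (N, i.2.*2.+1) else (i.1.-1, i.2).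

Lemma hotelK N : cancel (hotel N) (hotel_inv N).
Proof.
case=> m k; rewrite /hotel /hotel_inv /=; case: (eqVneq m N) => [->|mN] /=.
  by have := odd_double_half k; case: (odd k); rewrite ?add1n ?add0n => E; rewrite /= ?eqxx E.
by rewrite eqSS (negPf mN).
Qed.

Lemma hotel_invK N : cancel (hotel_inv N) (hotel N).
Proof.
case=> [[|m] k]; rewrite /hotel /hotel_inv /=.
  by rewrite eqxx odd_double doubleK.
rewrite eqSS; case: (eqVneq m N) => [->|mN] /=; last by rewrite ?(negPf mN).
by rewrite ?eqxx /= odd_double /= uphalf_double.
Qed.

(** * The elementary embedding induced by a shift of words *)

Section Lift.
Variables (labx laby : seq word -> seq bool -> bool) (al : nat -> word).

Let shift := levelwise (fun l w => w ++ al l).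

Hypothesis lab_shift : forall s u, labx s u -> laby (shift s) u.

(** Where the label is new, row 0 now holds infinite stars. Moving up one row keeps all star sizes
    exact, at the price of surjectivity. *)
Definition shift_row s u (i : nat * nat) :=
  if labx s u == laby (shift s) u then i else (i.1.+1, i.2).

Let move_hub := hub_map shift shift_row.

Lemma shift_inj : injective shift.
Proof.
apply: levelwise_inj => l w w' E; have := congr1 size E.
rewrite !size_cat => /addIn sw.
by move/eqP: E; rewrite eqseq_cat // => /andP[/eqP].
Qed.

Lemma weight_shift t : weight laby (move_hub t) = weight labx t.
Proof.
case: t => [s [[[u [m k]] [|]]|]]; [ |by []|by rewrite /weight /= size_levelwise].
rewrite /move_hub /hub_map /shift_row /weight /row /=; have := @lab_shift s u.
by case: (labx s u) => [/(_ isT) -> //|_] /=; case: (laby (shift s) u).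
Qed.

Definition lift_vertex (v : nat) : nat :=
  if colour_of labx v is Some _ then
    if @pickle_inv (colour * nat)%type v is Some ((t, b), i) then vertex (move_hub t, b) i
    else 0
  (* Index [v.+1] exceeds the multiplicity of the root hub, so the image is again uncoloured. *)
  else vertex (([::], None), false) v.+1.

Lemma lift_vertexP v c i : colour_of labx v = Some c -> v = vertex c i ->
  lift_vertex v = vertex (move_hub c.1, c.2) i.
Proof. by rewrite /lift_vertex => -> ->; rewrite pickleK_inv; case: c. Qed.

Lemma mult_shift c : mult laby (move_hub c.1, c.2) = mult labx c.
Proof. by case: c => t [] //; apply: weight_shift. Qed.

Lemma colour_lift v : colour_of laby (lift_vertex v) =
  colour_map shift shift_row (colour_of labx v).
Proof.
case E : (colour_of labx v) => [c|].
  have [i vi im] := colour_someP E.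
  by rewrite (lift_vertexP E vi) colour_vertex mult_shift im.
by rewrite /lift_vertex E colour_vertex.
Qed.

Lemma lift_vertex_inj : injective lift_vertex.
Proof.
have sri s u : injective (shift_row s u).
  by rewrite /shift_row => -[m k] [m' k']; case: ifP => //= _ [-> ->].
have hi := hub_map_inj shift_inj sri.
have ci : injective (colour_map shift shift_row).
  apply: inj_omap => -[t b] [t' b'] E.
  by have /hi /= -> := congr1 fst E; have /= -> := congr1 snd E.
move=> v w E; have := colour_lift v; rewrite E colour_lift => /ci Ewv.
case Ev: (colour_of labx v) Ewv => [c|] Ew.
  have [i vi _] := colour_someP Ev; have [j wj _] := colour_someP Ew.
  move: E; rewrite (lift_vertexP Ev vi) (lift_vertexP Ew wj) => /vertex_inj[ij].
  by rewrite vi wj ij.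
by move: E; rewrite /lift_vertex Ev Ew => /vertex_inj[->].
Qed.

(** The injection [move_hub] is approximated by a bijection that agrees with it on [L] and respects
    multiplicities up to [N] both ways: words are treated by [bijection_extend], rows by the
    hotel. *)
Lemma colour_bijection (N : nat) (L : seq hub) : exists sg sg' f f',
  [/\ cancel sg sg', cancel sg' sg, (forall s, sg (behead s) = behead (sg s)),
      (forall s u, cancel (f s u) (f' (sg s) u)) /\
      (forall s u, cancel (f' s u) (f (sg' s) u)) &
      [/\ {in L, forall t, hub_map sg f t = move_hub t},
        (forall t i, i < N -> in_mult i (weight labx t) ->
          in_mult i (weight laby (hub_map sg f t))) &
        (forall t i, i < N -> in_mult i (weight laby t) ->
          in_mult i (weight labx (hub_map sg' f' t)))]].
Proof.
pose ws := flatten [seq t.1 | t <- L].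
have ext l : exists gg : (word -> word) * (word -> word),
    [/\ cancel gg.1 gg.2, cancel gg.2 gg.1 & {in ws, forall w, gg.1 w = w ++ al l}].
  have [|g [g' gP]] := @bijection_extend _ (fun w : word => w ++ al l) ws.
    move=> w w' E; have := congr1 size E; rewrite !size_cat => /addIn sw.
    by move/eqP: E; rewrite eqseq_cat // => /andP[/eqP].
  by exists (g, g').
have [gg ggP] := choice ext.
pose sg := levelwise (fun l => (gg l).1); pose sg' := levelwise (fun l => (gg l).2).
have sK : cancel sg sg' by apply: levelwiseK => l; have [] := ggP l.
have sK' : cancel sg' sg by apply: levelwiseK => l; have [] := ggP l.
pose rowof (t : hub) := if t.2 is Some (_, (m, _), _) then m else 0.
(* Row [M] is split by the hotel: [N <= M] makes its stars too large to be told from infinite ones,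
   and lying above the rows in [L] keeps [hotel M] equal to the shift there. *)
have [M NM rowM] : exists2 M, N <= M & {in L, forall t, rowof t < M}.
  exists (maxn N (\max_(t <- L) rowof t).+1); first exact: leq_maxl.
  by move=> t tL; rewrite leq_max ltnS leq_bigmax_seq ?orbT.
(* Off [L], the bijection [sg] may also lose labels; the hotel then runs backwards. *)
pose f s u := if labx s u == laby (sg s) u then id
  else if laby (sg s) u then hotel M else hotel_inv M.
pose f' s u := if labx (sg' s) u == laby s u then id
  else if laby s u then hotel_inv M else hotel M.
exists sg, sg', f, f'; split=> //.
- by move=> s; rewrite /sg levelwise_behead.
- split=> s u i; rewrite /f /f' ?sK ?sK'; case: (labx _ u == _) => //; case: ifP => _;
    by rewrite ?hotelK ?hotel_invK.
split.
- move=> [s o] tL; have E : sg s = shift s.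
    apply: levelwise_level => l ls; have [_ _ ->] // := ggP l.
    apply/flattenP; exists s; first by apply/mapP; exists (s, o).
    by rewrite -mem_rev mem_nth // size_rev.
  rewrite /move_hub /hub_map /= E; congr (_, _).
  case: o tL => [[[u [m k]] b]|] //= tL; congr (Some (_, _, _)).
  rewrite /f /shift_row E; have := @lab_shift s u.
  case: (labx s u) => [/(_ isT) -> //|_]; case: (laby _ u); last by [].
  by rewrite /hotel /= ltn_eqF //; apply: rowM tL.
- case=> [s [[[u [m k]] [|]]|]] i iN;
    [ |by []|by rewrite /weight /= size_levelwise].
  rewrite /weight /row /hub_map /f /=.
  case: (labx s u); case: (laby (sg s) u) => //=.
    rewrite /hotel_inv /=; case: m => [|m] /=; first by lia.
      by rewrite eqSS; case: (eqVneq m M) => [->|_] //=; lia.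
  by rewrite /hotel /=; case: eqP => [->|_] //=; case: (odd k) => /=; lia.
- case=> [s [[[u [m k]] [|]]|]] i iN;
    [ |by []|by rewrite /weight /= size_levelwise].
  rewrite /weight /row /hub_map /f' /=.
  case: (labx (sg' s) u); case: (laby s u) => //=.
    by rewrite /hotel /=; case: eqP => [->|_] //=; case: (odd k) => /=; lia.
  rewrite /hotel_inv /=; case: m => [|m] /=; first by lia.
    by rewrite eqSS; case: (eqVneq m M) => [->|_] //=; lia.
Qed.

(** The embedding is fixed in advance, while the colour bijection depends on the formula and on the
    hubs of the finitely many values it reads. *)
Lemma star_graph_embeds : elem_embeddable (star_graph labx) (star_graph laby).
Proof.
exists lift_vertex => phi s; have [N phiN] := vars_below_exists phi.
pose L := pmap (fun v => omap fst (colour_of labx v)) [seq s i | i <- iota 0 N].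
have [sg [sg' [f [f' [sK sK' sb [fK fK'] [agree simx simy]]]]]] := colour_bijection N L.
apply: (@colour_equiv (option colour) (colour_of labx) (colour_of laby)
  (colour_map sg f) (colour_map sg' f') N (star_graph labx) (star_graph laby) phi s
  (lift_vertex \o s) (colour_mapK sK fK) (colour_mapK sK' fK') _ _ _ phiN).
- move=> a a' b b' ca cb; rewrite /star_graph /= ca cb adjacent_map //.
  exact: can_inj (hub_mapK sK fK).
- by move=> c l ul lN; apply: (fibre_transfer simx ul lN).
- by move=> c l ul lN; apply: (fibre_transfer simy ul lN).
- move=> i iN; rewrite /= colour_lift; case E: (colour_of labx (s i)) => [[t b]|] //=.
  rewrite agree // mem_pmap; apply/mapP; exists (s i); last by rewrite E.
  by apply/mapP; exists i; rewrite ?mem_iota.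
- by move=> i j _ _ /=; split=> [->//|/lift_vertex_inj].
Qed.

End Lift.

(** * From elementary embeddings to branches *)

Fixpoint distinct_from (k : nat) (vs : seq nat) : gformula :=
  if vs is j :: vs' then GAnd (GNot (GEq k j)) (distinct_from k vs') else GEq 0 0.

Lemma gsat_distinct_from G s k vs :
  gsat G s (distinct_from k vs) <-> s k \notin map s vs.
Proof.
elim: vs => [|j vs IH] //=; rewrite IH inE negb_or.
by split=> [[/eqP-> ->]|/andP[/eqP ? ?]].
Qed.

(** Variables 0 and 1 hold the two vertices, and variables 2 to [k.+1] the neighbours already
    chosen; [q] further ones are required. *)
Fixpoint common_neighbours (k q : nat) : gformula :=
  if q is q'.+1 then
    GEx k.+2 (GAnd (GAnd (GEdge 0 k.+2) (GEdge 1 k.+2))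
      (GAnd (distinct_from k.+2 (iota 2 k)) (common_neighbours k.+1 q')))
  else GEq 0 0.

Definition has_common_neighbours (G : graph_code) (q a b : nat) : Prop :=
  exists l, [/\ uniq l, size l = q & forall z, z \in l -> G (a, z) /\ G (b, z)].

Lemma gsat_common_neighbours_from G k q s :
  gsat G s (common_neighbours k q) <->
  exists l, [/\ uniq l, size l = q, forall z, z \in l -> G (s 0, z) /\ G (s 1, z) &
    forall z, z \in l -> z \notin map s (iota 2 k)].
Proof.
elim: q k s => [|q IH] k s /=.
  by split=> // _; exists [::].
have old a : map (fun i => if i == k.+2 then a else s i) (iota 2 k) = map s (iota 2 k).
  apply/eq_in_map => i; rewrite mem_iota => /andP[_ ik]; case: eqP => // E.
  by move: ik; rewrite E add2n ltnn.
have new a : map (fun i => if i == k.+2 then a else s i) (iota 2 k.+1) =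
    rcons (map s (iota 2 k)) a.
  have -> : iota 2 k.+1 = rcons (iota 2 k) k.+2 by rewrite -(addn1 k) iotaD cats1 addn1.
  by rewrite map_rcons old eqxx.
split.
  case=> a; rewrite gsat_distinct_from IH old new !eqxx /=.
  move=> [[sa ta] [na [l [ul sl lG ln]]]]; exists (a :: l); split=> /=.
  - rewrite ul andbT; apply/negP => /ln; rewrite mem_rcons inE eqxx //.
  - by rewrite sl.
  - by move=> z; rewrite inE => /predU1P[->//|/lG].
  - move=> z; rewrite inE => /predU1P[->//|/ln].
    by rewrite mem_rcons inE negb_or => /andP[].
case=> -[|a l] [] //= /andP[al ul] [sl] lG ln; exists a.
rewrite gsat_distinct_from IH old new !eqxx /=; split.
  by apply: lG; rewrite inE eqxx.
split; first by apply: ln; rewrite inE eqxx.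
exists l; split=> // z zl; first by apply: lG; rewrite inE zl orbT.
rewrite mem_rcons inE negb_or ln ?inE ?zl ?orbT // andbT.
by apply: contraNneq al => <-.
Qed.

Lemma gsat_common_neighbours G q s :
  gsat G s (common_neighbours 0 q) <-> has_common_neighbours G q (s 0) (s 1).
Proof.
rewrite gsat_common_neighbours_from.
by split=> [[l [ul sl lG _]]|[l [ul sl lG]]]; exists l; split.
Qed.

Lemma elementary_common_neighbours G H h : elementary_embedding G H h ->
  forall q a b, has_common_neighbours G q a b <-> has_common_neighbours H q (h a) (h b).
Proof.
move=> eh q a b.
by have := eh (common_neighbours 0 q) (nth b [:: a]); rewrite !gsat_common_neighbours.
Qed.

Lemma elementary_inj G H h : elementary_embedding G H h -> injective h.
Proof.
by move=> eh a b hab; have [_ +] := eh (GEq 0 1) (nth b [:: a]); apply.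
Qed.

Definition below (q : nat) (w : option nat) : bool := if w is Some m then q <= m else true.

Lemma below_inj w w' : (forall q, below q w = below q w') -> w = w'.
Proof.
case: w w' => [m|] [m'|] E //.
- congr Some; apply/eqP; rewrite eqn_leq.
  by have := E m; have := E m'; rewrite /= !leqnn => -> <-.
- by have := E m.+1; rewrite /= ltnn.
- by have := E m'.+1; rewrite /= ltnn.
Qed.

Section Common.
Variable lab : seq word -> seq bool -> bool.
Let G := star_graph lab.
Let col := colour_of lab.

(** Since [parent] has no 2-cycles, the common neighbours of a hub and its parent are exactly the
    copies of the link between them. *)
Lemma common_neighbours_link v w t q : col v = Some (t, false) ->
  col w = Some (parent t, false) -> parent t != t ->
  has_common_neighbours G q v w <-> below q (weight lab t).
Proof.
move=> cv cw pt; rewrite /has_common_neighbours; split.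
  case=> l [ul sl lG].
  have cl : {in l, forall z, col z = Some (t, true)}.
    move=> z /lG; rewrite /G /star_graph /= -/col cv cw /=.
    case: (col z) => [[l' b']|] [] //= /andP[-> H1] /andP[_ H2].
    congr (Some (_, _)); apply/esym/eqP; apply: contraNT pt => tl; apply/eqP.
    move: H1 H2; rewrite /incident (negPf tl) /= => /eqP tpl /orP[] /eqP ptl.
      by apply: parent_parent; rewrite ptl -tpl.
    by rewrite ptl -tpl.
  have := fibre_size ul cl; rewrite sl /mult /=.
  case: (weight lab t) => [m|] //= H; rewrite leqNgt; apply/negP => mq.
  by have := H _ mq; rewrite ltnn.
move=> qt; exists [seq vertex (t, true) i | i <- iota 0 q].
rewrite size_map size_iota map_inj_uniq ?iota_uniq; last by move=> i j /vertex_inj[].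
split=> // z /mapP[i]; rewrite mem_iota => /= iq ->.
rewrite /G /star_graph /= -/col cv cw /col colour_vertex /mult /=.
have -> /= : in_mult i (weight lab t).
  by move: qt; case: (weight lab t) => //= m; apply: leq_trans.
by rewrite /incident !eqxx orbT.
Qed.

(** A link vertex has only two neighbours, its end hubs; so [v] and [w] are hubs, the two ends of a
    link. The threshold 3 loses nothing, since every link except the loop at the root has weight at
    least 3. *)
Lemma three_common_neighbours v w : v != w -> has_common_neighbours G 3 v w ->
  exists t, parent t != t /\
    ((col v = Some (t, false) /\ col w = Some (parent t, false)) \/
     (col v = Some (parent t, false) /\ col w = Some (t, false))).
Proof.
move=> vw [l [ul sl lG]].
have lE z : z \in l -> exists2 c, col z = Some c &
    adjacent (col v) (Some c) /\ adjacent (col w) (Some c).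
  move=> /lG; rewrite /G /star_graph /= -/col; case: (col z) => [c|]; first by exists c.
  by case: (col v) => [[? ?]|] [].
have [z zl] : exists z, z \in l by case: l sl {ul lG lE} => // z l; exists z; rewrite inE eqxx.
have [[t [|]] cz [av aw]] := lE z zl.
  have hubs x : adjacent (col x) (Some (t, true)) ->
      col x = Some (t, false) \/ col x = Some (parent t, false).
    by case: (col x) => [[t' []]|] //= /orP[] /eqP->; [left|right].
  have pt : parent t != t.
    apply: contraNneq vw => pt; apply/eqP; move: (hubs v av) (hubs w aw).
    by rewrite pt => -[] cv -[] cw; apply: hub_unique cv cw.
  exists t; split; first exact: pt.
  move: (hubs v av) (hubs w aw) => -[] cv -[] cw.
  - by move: vw; rewrite (hub_unique cv cw) eqxx.
  - by left.
  - by right.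
  - by move: vw; rewrite (hub_unique cv cw) eqxx.
have [l' cv] : exists l', col v = Some (l', true).
  by move: av; case: (col v) => [[l' []]|] //= _; exists l'.
have sub : {subset l <= [:: vertex (l', false) 0; vertex (parent l', false) 0]}.
  move=> x /lE[[t' b'] cx [+ _]]; rewrite cv /= => /andP[/negPf b'f].
  have [i xi] := colour_someP cx; rewrite b'f in xi *; case: i xi => //= -> _ /orP[] /eqP->.
    by rewrite inE eqxx.
  by rewrite !inE eqxx orbT.
by have := uniq_leq_size ul sub; rewrite sl.
Qed.

End Common.

Section Converse.
Variables (labx laby : seq word -> seq bool -> bool) (h : nat -> nat).
Hypothesis eh : elementary_embedding (star_graph labx) (star_graph laby) h.

Let im (t : hub) : option colour := colour_of laby (h (vertex (t, false) 0)).

(** Elementary maps preserve the number of common neighbours, hence links and weights. The direction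
    of the image link remains open at this stage. *)
Lemma link_image t : parent t != t -> below 3 (weight labx t) ->
  exists t', weight laby t' = weight labx t /\
    ((im t = Some (t', false) /\ im (parent t) = Some (parent t', false)) \/
     (im t = Some (parent t', false) /\ im (parent t) = Some (t', false))).
Proof.
move=> pt w3; pose v := vertex (t, false) 0; pose w := vertex (parent t, false) 0.
have cv : colour_of labx v = Some (t, false) by rewrite colour_vertex.
have cw : colour_of labx w = Some (parent t, false) by rewrite colour_vertex.
have cn := elementary_common_neighbours eh.
have vw : h v != h w.
  by rewrite (inj_eq (elementary_inj eh)); apply: contraNneq pt => /vertex_inj[<-].
have sym q a b : has_common_neighbours (star_graph laby) q a b <->
    has_common_neighbours (star_graph laby) q b a.
  by split=> -[l [ul sl lG]]; exists l;
    (split; [exact: ul|exact: sl|move=> z /lG[za zb]; exact: (conj zb za)]).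
have [|t' [pt' H]] := @three_common_neighbours laby _ _ vw.
  by apply/cn; apply/(common_neighbours_link _ cv cw pt).
exists t'; split; last exact: H.
apply: below_inj => q; apply/idP/idP => Hq.
  apply/(common_neighbours_link _ cv cw pt)/cn; case: H => -[c c'].
    by apply/(common_neighbours_link _ c c' pt').
  by apply/sym/(common_neighbours_link _ c' c pt').
move/(common_neighbours_link _ cv cw pt)/cn: Hq; case: H => -[c c'].
  by move/(common_neighbours_link _ c c' pt').
by move/sym/(common_neighbours_link _ c' c pt').
Qed.

Let node n : hub := (nseq n [::], None).

Lemma node_image_or n : exists s, size s = n.+1 /\
  ((im (node n.+1) = Some (s, None, false) /\ im (node n) = Some (behead s, None, false)) \/
   (im (node n.+1) = Some (behead s, None, false) /\ im (node n) = Some (s, None, false))).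
Proof.
have [| |[s o] [+ H]] := @link_image (node n.+1).
- by apply/eqP => -[/(congr1 size)/=]; lia.
- by rewrite /= size_nseq; lia.
rewrite /weight /= size_nseq; case: o H => [[i []]|] /= H.
- by rewrite /row; case: ifP => _; case: i.2.1 => [|m] //= -[?]; lia.
- by move=> [?]; lia.
by move=> [sn]; exists s; split; [lia|].
Qed.

Lemma node_image n : exists s, [/\ size s = n.+1,
  im (node n.+1) = Some (s, None, false) & im (node n) = Some (behead s, None, false)].
Proof.
have [s [sn [[E1 E2]|[E1 E2]]]] := node_image_or n; first by exists s.
(* A reversed link would place the image of [node n.+1] at level [n], but the next link requires
   level [n.+1] or [n.+2]. *)
have [s' [sn']] := node_image_or n.+1; rewrite E1.
by move=> [[_ [E]]|[_ [E]]]; have := congr1 size E; rewrite ?size_behead; lia.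
Qed.

(** At the [n]-th node of empty words, the label [mkseq x n] has infinite stars in row 0. The centre
    of one is sent to a centre over [be n] with the same label, read off the weight; the infinite
    link to its dummy end then has an infinite image. *)
Lemma branch_of_embedding (x : nat -> bool) :
  (forall n, labx (nseq n [::]) (mkseq x n)) ->
  exists be : nat -> seq word, [/\ forall n, size (be n) = n,
    forall n, behead (be n.+1) = be n & forall n, laby (be n) (mkseq x n)].
Proof.
move=> lx; pose be n := if im (node n) is Some (s, _, _) then s else [::].
have bE n : im (node n) = Some (be n, None, false).
  by have [s [_ _ E]] := node_image n; rewrite /be E.
exists be; split=> n.
- by have [s [sn _ E]] := node_image n; rewrite /be E size_behead sn.
- by have [s [_ E1 E2]] := node_image n; rewrite /be E1 E2.
pose cen : hub := (nseq n [::], Some (mkseq x n, (0, 0), false)).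
pose dum : hub := (nseq n [::], Some (mkseq x n, (0, 0), true)).
have [| |tc [wc Hc]] := @link_image cen; [by apply/eqP => -[]|by rewrite /= addn4|].
have [[j k] [E1 E2]] : exists jk,
    be n = tc.1 /\ im cen = Some (tc.1, Some (mkseq x n, jk, false), false).
  case: tc wc Hc => [s [[i []]|]] /=; rewrite /weight /=.
  - by rewrite /row; case: ifP => _; case: i.2.1 => [|m] //= -[?]; lia.
  - move=> [E]; rewrite (bE n) => -[[-> [->]]|[_ //]]; exists i.2; split=> //.
    have /(pcan_inj (@pickleK _)) <- : pickle i.1 = pickle (mkseq x n) by lia.
    by case: i {E}.
  - by move=> [?]; lia.
have [| |td [wd Hd]] := @link_image dum; [by apply/eqP => -[]|by rewrite /weight /= /row lx|].
move: wd Hd; rewrite /weight /= /row lx; case: td => [s [[i []]|]] //=.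
(* An infinite weight occurs only in row 0 of a label that is present. *)
case: ifP => // ls _; rewrite E2 => -[[_ [Es Ei]]|[_ //]].
by move: ls; rewrite E1 Es -Ei.
Qed.

End Converse.

(** * Coding analytic quasi-orders on Polish spaces *)

Local Open Scope classical_set_scope.
Local Open Scope nat_scope.

Definition converges (X : topologicalType) (z : nat -> X) (p : X) : Prop :=
  forall A : set X, open A -> A p -> exists N, forall n, N <= n -> A (z n).

Definition radius (n : nat) : Rdefinitions.R := Rinv (INR n.+1).

Lemma radius_gt0 n : Rlt R0 (radius n).
Proof. by apply: Rinv_0_lt_compat; apply: lt_0_INR; lia. Qed.

Lemma radius_small e : Rlt R0 e -> exists N, forall n, N <= n -> Rlt (radius n) e.
Proof.
move=> e0; have [[|N] [Ne N0]] := archimed_cor1 e e0; first by lia.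
exists N => n Nn; apply: Rle_lt_trans Ne; apply: Rinv_le_contravar.
  by apply: lt_0_INR; lia.
by apply: le_INR; lia.
Qed.

Section Polish.
Variables (X : topologicalType) (d : X -> X -> Rdefinitions.R).
Hypothesis dP : compatible_complete_metric d.

Lemma metric_pos x y : Rle R0 (d x y).
Proof.
have [d0 ds dt _ _] := dP; have := dt x y x; rewrite (ds y x).
by have -> : d x x = R0 by [apply/d0]; lra.
Qed.

Lemma metric_refl x : d x x = R0.
Proof. by have [d0 _ _ _ _] := dP; apply/d0. Qed.

Lemma open_ball x r : open [set y | Rlt (d x y) r].
Proof.
have [_ _ dt dopen _] := dP; apply/dopen => y /= xy.
exists (Rminus r (d x y)); split=> [|z yz]; first by lra.
by have := dt x y z; lra.
Qed.

Lemma converges_metric (z : nat -> X) p :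
  converges z p <-> forall e, Rlt R0 e -> exists N, forall n, N <= n -> Rlt (d (z n) p) e.
Proof.
have [_ ds _ dopen _] := dP; split=> [zp e e0|H A].
  have [|N HN] := zp _ (open_ball p e) _; first by rewrite /= metric_refl.
  by exists N => n /HN; rewrite /= ds.
move/dopen => oA /oA[e [e0 eA]]; have [N HN] := H e e0.
by exists N => n /HN; rewrite ds => /eA.
Qed.

Lemma converges_unique (z : nat -> X) p q : converges z p -> converges z q -> p = q.
Proof.
have [d0 ds dt _ _] := dP; move=> /converges_metric zp /converges_metric zq.
apply/d0; case: (Rle_lt_or_eq_dec _ _ (metric_pos p q)) => // pq.
have h0 : Rlt R0 (Rdiv (d p q) 2) by lra.
have [N HN] := zp _ h0; have [M HM] := zq _ h0.
have := HN (maxn N M) (leq_maxl _ _); have := HM (maxn N M) (leq_maxr _ _).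
by have := dt p (z (maxn N M)) q; rewrite (ds p (z _)); lra.
Qed.

Variables (D : set X) (c : X -> nat).
Hypotheses (cinj : {in D &, injective c}) (Ddense : closure D = setT).

Lemma dense_near x r : Rlt R0 r -> exists2 y, D y & Rlt (d y x) r.
Proof.
have [_ ds _ _ _] := dP => r0; have : closure D x by rewrite Ddense.
move=> /(_ [set y | Rlt (d x y) r]) [|y [Dy]]; last by rewrite /= ds; exists y.
by apply: open_nbhs_nbhs; split; [exact: open_ball|rewrite /= metric_refl].
Qed.

(** When [c] is injective on [D], this is a ball around the dense point numbered [k], or empty if
    there is none. *)
Definition net (l k : nat) : set X :=
  [set x | exists y, [/\ D y, c y = k & Rlt (d y x) (radius l)]].

Lemma open_net l k : open (net l k).
Proof.
have [_ _ dt dopen _] := dP; apply/dopen => x [y [Dy cy yx]].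
exists (Rminus (radius l) (d y x)); split=> [|z xz]; first by lra.
by exists y; split=> //; have := dt y x z; lra.
Qed.

Lemma net_cover l x : exists k, net l k x.
Proof. by have [y Dy yx] := dense_near x (radius_gt0 l); exists (c y), y. Qed.

Lemma net_close l k x y : net l k x -> net l k y -> Rlt (d x y) (Rplus (radius l) (radius l)).
Proof.
have [_ ds dt _ _] := dP => -[u [Du cu ux]] [v [Dv cv vy]].
have uv : u = v by apply: cinj; rewrite ?inE ?cv.
by have := dt x v y; rewrite (ds x v) -uv in vy *; lra.
Qed.

Lemma net_base A x : open A -> A x -> exists l k, net l k x /\ net l k `<=` A.
Proof.
have [_ _ _ dopen _] := dP => /dopen oA /oA[e [e0 eA]].
have [l Hl] := radius_small (e := Rdiv e 2) ltac:(lra).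
have [k xk] := net_cover l x; exists l, k; split=> // y yk; apply: eA.
by have := net_close xk yk; have := Hl l (leqnn l); lra.
Qed.

Lemma net_limit (a : nat -> nat) (z : nat -> X) :
  (forall n l, l < n -> net l (a l) (z n)) -> exists p, converges z p.
Proof.
have [_ _ _ _ complete] := dP => za; have [|p zp] := complete z.
  move=> e e0; have [l Hl] := radius_small (e := Rdiv e 2) ltac:(lra).
  exists l.+1 => m n lm ln; have := net_close (za m l lm) (za n l ln).
  by have := Hl l (leqnn l); lra.
by exists p; apply/converges_metric.
Qed.

End Polish.

Lemma polish_net (X : topologicalType) : polish X ->
  exists W : nat -> nat -> set X,
  [/\ forall l k, open (W l k), forall l x, exists k, W l k x,
    forall A x, open A -> A x -> exists l k, W l k x /\ W l k `<=` A &
    forall a z, (forall n l, l < n -> W l (a l) (z n)) -> exists p, converges z p].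
Proof.
move=> [[D [/countable_injP[c cinj] Ddense]] [d dP]]; exists (net d D c); split.
- exact: open_net.
- exact: net_cover.
- exact: net_base.
- exact: net_limit.
Qed.

Lemma polish_converges_unique (X : topologicalType) (z : nat -> X) p q :
  polish X -> converges z p -> converges z q -> p = q.
Proof. by move=> [_ [d dP]]; apply: (converges_unique dP). Qed.

Lemma converges_continuous (X Y : topologicalType) (f : Y -> X) (z : nat -> Y) p :
  continuous f -> converges z p -> converges (f \o z) (f p).
Proof. by move=> /continuousP fc zp A oA Afp; apply: (zp (f @^-1` A)) => //; apply: fc. Qed.

Lemma continuous_fst (X Y Z : topologicalType) (f : Y -> X * Z) :
  continuous f -> continuous (fst \o f).
Proof.
move=> fc q; apply: (@continuous_comp _ _ _ f fst q (fc q)).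
by case: (f q) => a b; exact: cvg_fst.
Qed.

Lemma continuous_snd (X Y Z : topologicalType) (f : Y -> X * Z) :
  continuous f -> continuous (snd \o f).
Proof.
move=> fc q; apply: (@continuous_comp _ _ _ f snd q (fc q)).
by case: (f q) => a b; exact: cvg_snd.
Qed.

(** * Codes of points and of witnesses *)

Section Coding.
Variables (X : topologicalType) (U : nat -> set X).
Hypotheses (Uopen : forall l, open (U l))
  (Ubase : forall A x, open A -> A x -> exists l, U l x /\ U l `<=` A).
Hypothesis pX : polish X.

Definition code (x : X) (l : nat) : bool := `[< U l x >].

(* [u] need not be the code of a point: limits of codes are only upper bounds. *)
Definition bounds (u : nat -> bool) (x : X) : Prop := forall l, U l x -> u l.

Definition determines (u : nat -> bool) (x : X) : Prop :=
  bounds u x /\ forall y, bounds u y -> y = x.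

(** Openness of [U l] makes [u] an upper bound for [p]. If [u] bounds [y], every basic neighbourhood
    of [y] eventually contains [z n], so [z] converges to [y] as well. *)
Lemma determines_limit u (z : nat -> X) p :
  (forall n l, l < n -> u l = code (z n) l) -> converges z p -> determines u p.
Proof.
move=> uz zp; split=> [l Ulp|y uy].
  have [N HN] := zp _ (Uopen l) Ulp; rewrite (uz (maxn N l.+1)); last by rewrite leq_maxr.
  by apply/asboolP/HN; rewrite leq_maxl.
apply: polish_converges_unique pX _ zp => A oA Ay.
have [l [Uly UA]] := Ubase oA Ay; exists l.+1 => n ln; apply: UA.
by apply/asboolP; rewrite -/(code (z n) l) -uz //; apply: uy.
Qed.

Lemma determines_code x : determines (code x) x.
Proof. by apply: (@determines_limit _ (fun=> x)) => // A _ Ax; exists 0. Qed.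

Lemma determines_unique u x y : determines u x -> determines u y -> x = y.
Proof. by move=> [_ ux] [/ux]. Qed.

Variables (R : X -> X -> Prop) (Y : topologicalType) (f : Y -> X * X).
Variable W : nat -> nat -> set Y.
Hypotheses (Rqo : quasi_order R) (fc : continuous f)
  (fR : f @` setT = [set p : X * X | R p.1 p.2]).
Hypotheses (Wcover : forall l z, exists k, W l k z)
  (Wlimit : forall a z, (forall n l, l < n -> W l (a l) (z n)) -> exists p, converges z p).

Definition witnessed (n : nat) (u v : nat -> bool) (a : nat -> nat) : Prop :=
  exists z, forall l, l < n ->
    [/\ W l (a l) z, u l = code (f z).1 l & v l = code (f z).2 l].

Lemma witnessed_ext n u u' v v' a a' :
  (forall l, l < n -> [/\ u l = u' l, v l = v' l & a l = a' l]) ->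
  witnessed n u v a -> witnessed n u' v' a'.
Proof.
move=> E [z H]; exists z => l ln; have [Wz uz vz] := H l ln.
by have [<- <- <-] := E l ln.
Qed.

Lemma witnessed_restrict m n u v a : m <= n -> witnessed n u v a -> witnessed m u v a.
Proof. by move=> mn [z H]; exists z => l lm; apply: H; apply: leq_trans mn. Qed.

(** The finite-stage witnesses share the balls [W l (a l)], so they converge in [Y]; continuity of
    [f] carries this to both coordinates. *)
Lemma witnessed_limit u v a : (forall n, witnessed n u v a) ->
  exists x y, [/\ R x y, determines u x & determines v y].
Proof.
move=> /choice[z zP]; have [|p zp] := Wlimit (a := a) (z := z).
  by move=> n l /zP[].
exists (f p).1, (f p).2; split.
- by have : [set q : X * X | R q.1 q.2] (f p) by rewrite -fR; exists p.
- apply: (@determines_limit _ (fun n => (f (z n)).1)); first by move=> n l /zP[].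
  exact: converges_continuous (continuous_fst fc) zp.
- apply: (@determines_limit _ (fun n => (f (z n)).2)); first by move=> n l /zP[].
  exact: converges_continuous (continuous_snd fc) zp.
Qed.

(** In the limit each step relates two points. The bits between consecutive steps determine a single
    point, where the steps meet, and transitivity composes them. *)
Lemma chain_sound k u v al x y : (forall n, chain witnessed n k u v al) ->
  determines u x -> determines v y -> R x y.
Proof.
have [Rr Rt] := Rqo; elim: k u al x => [|k IH] u al x /= ch ux vy.
  have uv : u = v by apply: funext => l; have [] := ch l.+1 l (ltnSn l).
  by rewrite (determines_unique ux (_ : determines u y)) // uv.
have [|x' [y' [Rxy ux' vy']]] := @witnessed_limit u
  (fun l => (head (0, false) (al l)).2) (fun l => (head (0, false) (al l)).1).
  by move=> n; have [] := ch n.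
rewrite (determines_unique ux ux'); apply: Rt Rxy _; apply: IH vy' vy => n.
by have [_ _] := ch n; apply.
Qed.

Lemma linked_code x y :
  R x y <-> exists al, forall n, linked witnessed n (code x) (code y) al.
Proof.
split=> [Rxy|[al lk]].
  have : [set q : X * X | R q.1 q.2] (x, y) by [].
  rewrite -fR => -[z _ fz]; have [a az] := choice (fun l => Wcover l z).
  exists (fun l => [:: (a l, code y l)]) => n; exists 1; split=> //=.
  by exists z => l _; rewrite fz.
(* The length found at [n = 1] serves all [n]; passing through [n.+1] keeps the number of levels
   positive. *)
have [k ch] := lk 1; apply: (chain_sound (k := k) (al := al)) (determines_code x)
   (determines_code y).
move=> n; have [k' ch'] := lk n.+1.
have ekk : k' = k by rewrite -(chain_size ch (ltnSn 0)) -(chain_size ch' (ltn0Sn n)).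
move: ch'; rewrite ekk; apply: chain_restrict (leqnSn n); exact: witnessed_restrict.
Qed.

End Coding.

(** * The Borel reduction *)

Lemma cvg_graph_code (F : set_system graph_code) (G : graph_code) :
  Filter F -> (forall p, F [set H : graph_code | H p = G p]) -> F --> G.
Proof.
move=> FF FG; apply/cvg_sup => p A; rewrite nbhsE => -[_ [[C _ <-] CG] CA].
by apply: filterS (FG p) => H HG; apply: CA; move: CG; rewrite /preimage /= HG.
Qed.

(** The sets containing [F c'] for all [c'] that agree with [c] far enough form a filter, which
    converges to [F c] coordinatewise. *)
Lemma open_finite_dependence (F : (nat -> bool) -> graph_code) (A : set graph_code) c :
  (forall p, exists n, forall c', (forall l, l < n -> c l = c' l) -> F c p = F c' p) ->
  open A -> A (F c) ->
  exists n, forall c', (forall l, l < n -> c l = c' l) -> A (F c').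
Proof.
move=> Fdep oA AF.
pose S : set_system graph_code :=
  [set B | exists n, forall c', (forall l, l < n -> c l = c' l) -> B (F c')].
have FS : Filter S.
  split; first by exists 0.
    move=> B C [m HB] [n HC]; exists (maxn m n) => c' cc'; split.
      by apply: HB => l lm; apply: cc'; rewrite leq_max lm.
    by apply: HC => l ln; apply: cc'; rewrite leq_max ln orbT.
  by move=> B C BC [n HB]; exists n => c' /HB/BC.
apply: (@cvg_graph_code S (F c) FS _ A); last by apply: open_nbhs_nbhs.
by move=> p; have [n Hn] := Fdep p; exists n => c' /Hn /= ->.
Qed.

Lemma borel_fun_open (X Z : topologicalType) (f : X -> Z) :
  (forall A, open A -> borel (f @^-1` A)) -> borel_fun f.
Proof.
have [b0 bC bU] := smallest_sigma_algebra setT (@open X) => fo B; move: B.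
apply: smallest_sub => //; split=> [|A fA|A fA]; rewrite /=.
- by rewrite preimage_set0; apply: b0.
- by rewrite setTD preimage_setC -setTD; apply: bC.
- by rewrite preimage_bigcup; apply: bU.
Qed.

(** Taking codes is Borel and [F] is continuous on the Cantor space: the preimage of an open set is
    the countable union of the code cylinders that [F] sends into it. *)
Lemma borel_finite_dependence (X : topologicalType) (U : nat -> set X)
    (F : (nat -> bool) -> graph_code) :
  (forall l, open (U l)) ->
  (forall p c, exists n, forall c', (forall l, l < n -> c l = c' l) -> F c p = F c' p) ->
  borel_fun (fun x => F (code U x)).
Proof.
move=> Uo Fdep; have [b0 bC bU] := smallest_sigma_algebra setT (@open X).
apply: borel_fun_open => A oA.
have bcode l b : borel [set x | code U x l = b].
  have bUl : borel (U l) by apply: sub_sigma_algebra.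
  case: b.
    by rewrite (_ : [set _ | _] = U l) //; apply/seteqP; split=> x /asboolP.
  rewrite (_ : [set _ | _] = setT `\` U l); first exact: bC.
  apply/seteqP; split=> x /=; first by move/negbT/asboolPn.
  by move=> [_ nU]; apply/negbTE/asboolPn.
have bcyl (p : seq bool) : borel [set x | forall l, l < size p -> code U x l = nth false p l].
  rewrite (_ : [set _ | _] = setT `\` \bigcup_l
    (if l < size p then [set x | code U x l = ~~ nth false p l] else set0)).
    by apply: bC; apply: bU => l; case: ifP => _; [apply: bcode|apply: b0].
  apply/seteqP; split=> x /= H.
    by split=> // -[l _]; case: ifP => // lp /=; rewrite H //; case: nth.
  move=> l lp; case: H => _ H; apply/eqP; apply: contra_notT H => /eqP ne.
  by exists l => //; rewrite lp /=; move: ne; case: code; case: nth.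
pose good (p : seq bool) :=
  forall c, (forall l, l < size p -> c l = nth false p l) -> A (F c).
pose cyl (o : option (seq bool)) : set X := if o is Some p then
  (if `[< good p >] then [set x | forall l, l < size p -> code U x l = nth false p l]
   else set0) else set0.
have bcyl' o : borel (cyl o).
  by case: o => [p|] /=; [case: ifP => _; [apply: bcyl|apply: b0]|apply: b0].
rewrite (_ : _ @^-1` A = \bigcup_k cyl (unpickle k)); first by apply: bU => k; exact: bcyl'.
apply/seteqP; split=> x.
  move=> AF; have [n Hn] := open_finite_dependence (fun p => Fdep p (code U x)) oA AF.
  have gp : good (mkseq (code U x) n).
    move=> c; rewrite size_mkseq => H; apply: Hn => l ln.
    by rewrite H // nth_mkseq.
  have : cyl (Some (mkseq (code U x) n)) x.
    by rewrite /cyl asboolT // => l; rewrite size_mkseq => ln; rewrite nth_mkseq.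
  by rewrite -[Some _]pickleK => cx; exists (pickle (mkseq (code U x) n)).
by move=> [k _]; case: (unpickle k) => [p|] //; rewrite /cyl; case: asboolP => // gp; apply: gp.
Qed.

(** The colour of a vertex depends on the labels at one node [s] only, hence on [size s] bits. *)
Lemma star_graph_finite_dependence step :
  (forall n u u' v v' a a',
    (forall l, l < n -> [/\ u l = u' l, v l = v' l & a l = a' l]) ->
    step n u v a -> step n u' v' a') ->
  forall p c, exists n, forall c', (forall l, l < n -> c l = c' l) ->
    star_graph (label step c) p = star_graph (label step c') p.
Proof.
move=> sext p c.
have dep v : exists n, forall c', (forall l, l < n -> c l = c' l) ->
    colour_of (label step c) v = colour_of (label step c') v.
  rewrite /colour_of; case: (@pickle_inv (colour * nat)%type v) => [[[[s o] b] i]|];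
    last by exists 0.
  exists (size s) => c' /(label_ext sext) cc'.
  by case: b o => -[[i' []]|] //; rewrite /mult /weight /row /= cc'.
have [m Hm] := dep p.1; have [n Hn] := dep p.2.
exists (maxn m n) => c' cc'; rewrite /star_graph (Hm c') ?(Hn c') //.
  by move=> l ln; apply: cc'; rewrite leq_max ln orbT.
by move=> l lm; apply: cc'; rewrite leq_max lm.
Qed.

Lemma quasi_order_reduction (X : topologicalType) (R : X -> X -> Prop) :
  polish X -> sigma11_quasi_order R -> borel_reducible_to_graphs R elem_embeddable.
Proof.
move=> pX [Rqo [Y [f [pY fc fR]]]].
have [V [Vopen _ Vbase _]] := polish_net pX.
have [W [_ Wcover _ Wlimit]] := polish_net pY.
(* The doubly indexed base is listed as one sequence, with the empty set at numbers coding no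
   pair. *)
pose U k : set X := if @unpickle (nat * nat)%type k is Some i then V i.1 i.2 else set0.
have Uopen l : open (U l).
  by rewrite /U; case: (@unpickle (nat * nat)%type l) => [i|]; [|exact: open0].
have Ubase A x : open A -> A x -> exists l, U l x /\ U l `<=` A.
  move=> oA Ax; have [l [k H]] := Vbase A x oA Ax.
  by exists (pickle (l, k)); rewrite /U pickleK.
pose wit := witnessed U f W.
have wext : forall n u u' v v' a a',
    (forall l, l < n -> [/\ u l = u' l, v l = v' l & a l = a' l]) ->
    wit n u v a -> wit n u' v' a' by exact: witnessed_ext.
have RE := linked_code Uopen Ubase pX Rqo fc fR Wcover Wlimit.
exists (fun x => star_graph (label wit (code U x))); split.
- apply: (borel_finite_dependence Uopen (F := fun c => star_graph (label wit c))).
  exact: star_graph_finite_dependence.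
- by move=> x; apply: star_graph_is_graph.
- move=> x y; rewrite RE; split=> [[al lk]|[h eh]].
    by apply: star_graph_embeds (label_shift wext lk).
  have [be [sz bh lab]] := branch_of_embedding eh (label_refl wit (code U x)).
  exact: linked_branch wext _ _ _ sz bh lab.
Qed.

(** * Analyticity *)

Definition agree (n : nat) (x y : nat -> nat) : Prop := forall k, k < n -> x k = y k.

Definition first_radius (P : pred nat) : Rdefinitions.R :=
  if pselect (exists k, P k) is left ex then radius (ex_minn ex) else R0.

Definition first_difference_distance (x y : nat -> nat) : Rdefinitions.R :=
  first_radius (fun k => x k != y k).

Lemma radius_lt m n : m < n -> Rlt (radius n) (radius m).
Proof.
move=> mn; apply: Rinv_lt_contravar; last by apply: lt_INR; lia.
by apply: Rmult_lt_0_compat; apply: lt_0_INR; lia.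
Qed.

Lemma distance_ge0 x y : Rle R0 (first_difference_distance x y).
Proof.
rewrite /first_difference_distance /first_radius; case: pselect => [ex|_]; last by lra.
by have := radius_gt0 (ex_minn ex); lra.
Qed.

(** The distance is [radius m] at the first difference [m], and [R0] if there is none; a smaller
    value than [radius n] excludes differences up to and including [n]. *)
Lemma distance_lt x y n :
  Rlt (first_difference_distance x y) (radius n) <-> agree n.+1 x y.
Proof.
rewrite /first_difference_distance /first_radius; case: pselect => [ex|nex].
  case: ex_minnP => m /eqP xym mmin; split=> [mn k kn|H].
    apply/eqP; apply: contraPT mn => /mmin mk.
    have /Rle_not_lt : Rle (radius n) (radius m).
      have : m <= n by lia.
      rewrite leq_eqVlt => /predU1P[->|/radius_lt]; lra.
    by [].
  by apply: radius_lt; rewrite ltnNge; apply/negP => mn; apply: xym; apply: H.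
split=> _; last exact: radius_gt0.
by move=> k _; apply/eqP; apply: contra_notT nex => xy; exists k.
Qed.

(** * Closed subspaces of the Baire space are Polish *)

Section BaireSubspace.
Variable K : set (nat -> nat).

Definition baire_subspace : Type := {x : nat -> nat | K x}.

HB.instance Definition _ := gen_eqMixin baire_subspace.
HB.instance Definition _ := gen_choiceMixin baire_subspace.

Definition baire_open (A : set baire_subspace) : Prop :=
  forall x, A x -> exists n, forall y, agree n (sval x) (sval y) -> A y.

Lemma baire_openT : baire_open setT.
Proof. by move=> x _; exists 0. Qed.

Lemma baire_openI : setI_closed baire_open.
Proof.
move=> A B oA oB x [/oA[m HA] /oB[n HB]]; exists (maxn m n) => y xy; split.
  by apply: HA => k km; apply: xy; rewrite leq_max km.
by apply: HB => k kn; apply: xy; rewrite leq_max kn orbT.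
Qed.

Lemma baire_open_bigcup (I : Type) (f : I -> set baire_subspace) :
  (forall i, baire_open (f i)) -> baire_open (\bigcup_i f i).
Proof. by move=> of_ x [i _ /of_[n H]]; exists n => y /H; exists i. Qed.

HB.instance Definition _ :=
  isOpenTopological.Build baire_subspace baire_openT baire_openI baire_open_bigcup.

Lemma baire_openE : @open baire_subspace = baire_open.
Proof. by []. Qed.

Lemma baire_nbhs n (x : baire_subspace) :
  nbhs x [set y : baire_subspace | agree n (sval x) (sval y)].
Proof.
apply: open_nbhs_nbhs; split; last by [].
rewrite baire_openE => y xy; exists n => z yz k kn.
by rewrite (xy k kn) (yz k kn).
Qed.

Hypothesis Kclosed : forall x, (forall n, exists2 y, K y & agree n x y) -> K x.

(** A dense set arises by choosing, for each finite sequence with an extension in [K], one such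
    extension. *)
Lemma baire_separable : separable_space baire_subspace.
Proof.
have [[y0]|nK] := pselect (exists y : baire_subspace, True); last first.
  exists set0; split; first exact: countable0.
  by apply/seteqP; split=> // y; case: nK; exists y.
have /choice[g gP] (p : seq nat) : exists y : baire_subspace,
    (exists z : baire_subspace, forall k, k < size p -> sval z k = nth 0 p k) ->
    forall k, k < size p -> sval y k = nth 0 p k.
  have [[z zp]|nz] := pselect (exists z : baire_subspace,
    forall k, k < size p -> sval z k = nth 0 p k); first by exists z.
  by exists y0.
exists (g @` setT); split.
  by apply: sub_countable (card_image_le _ _) _; apply: countableP.
apply/seteqP; split=> // x _ B; rewrite nbhsE => -[C [+ Cx] CB].
rewrite baire_openE => oC.
have [n Hn] := oC x Cx; pose q := mkseq (sval x) n.
exists (g q); split; first by exists q.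
apply: CB; apply: Hn => k kn; have := gP q; rewrite size_mkseq => -> //.
  by rewrite nth_mkseq.
by exists x => j jn; rewrite nth_mkseq.
Qed.

Lemma baire_polish : polish baire_subspace.
Proof.
split; first exact: baire_separable.
exists (fun x y => first_difference_distance (sval x) (sval y)); split.
- move=> [x Kx] [y Ky]; split=> [/= d0|->].
    have xy : x = y.
      apply: funext => k; have /distance_lt : Rlt (first_difference_distance x y) (radius k).
        by rewrite d0; apply: radius_gt0.
      by apply.
    by subst y; rewrite (Prop_irrelevance Kx Ky).
  by rewrite /first_difference_distance /first_radius; case: pselect => // ex;
    case: (ex_minnP ex) => k /eqP.
- by move=> x y; congr first_radius; apply: funext => k; rewrite eq_sym.
- move=> x y z; set a := first_difference_distance (sval x) (sval y).
  set b := first_difference_distance (sval y) (sval z).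
  have a0 : Rle R0 a := distance_ge0 _ _; have b0 : Rle R0 b := distance_ge0 _ _.
  rewrite {1}/first_difference_distance /first_radius; case: pselect => [ex|_]; last by lra.
  case: ex_minnP => m /eqP xz _; apply: Rnot_lt_le => lt; apply: xz.
  have /distance_lt xy : Rlt a (radius m) by lra.
  have /distance_lt yz : Rlt b (radius m) by lra.
  by rewrite xy ?yz.
- move=> A; rewrite baire_openE; split=> oA x Ax.
    have [n Hn] := oA x Ax; exists (radius n); split; first exact: radius_gt0.
    by move=> y /distance_lt xy; apply: Hn => k kn; apply: xy; apply: ltnW.
  have [e [e0 He]] := oA x Ax; have [N HN] := radius_small e0.
  exists N.+1 => y /distance_lt xy; apply: He.
  by have := HN N (leqnn N); lra.
- move=> u Cu; have /choice[N NP] k : exists N, forall m n, N <= m -> N <= n ->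
      agree k.+1 (sval (u m)) (sval (u n)).
    have [N HN] := Cu _ (radius_gt0 k).
    by exists N => m n Nm Nn; apply/distance_lt/HN.
  (* From [N k] on, the first [k.+1] terms no longer change, so the limit can be read off
     diagonally. *)
  pose l k := sval (u (N k)) k.
  have lE n m : N n <= m -> agree n.+1 l (sval (u m)).
    move=> nm k kn; pose M := maxn m (N k).
    rewrite (NP n m M) // ?leq_max ?nm //.
    by apply: (NP k (N k) M); rewrite ?leq_max ?leqnn ?orbT.
  have Kl : K l.
    apply: Kclosed => n; exists (sval (u (N n))); first exact: (svalP (u (N n))).
    by move=> k kn; apply: (lE n) => //; apply: ltnW.
  exists (exist _ l Kl) => e e0; have [n Hn] := radius_small e0.
  exists (N n) => m nm; have := Hn n (leqnn n).
  have /distance_lt : agree n.+1 (sval (u m)) l by move=> k kn; rewrite (lE n m).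
  by rewrite /=; lra.
Qed.

End BaireSubspace.

(** * Countability of formulas and codes of embeddings *)

Fixpoint formula_tree (phi : gformula) : GenTree.tree nat :=
  match phi with
  | GEq i j => GenTree.Node 0 [:: GenTree.Leaf i; GenTree.Leaf j]
  | GEdge i j => GenTree.Node 1 [:: GenTree.Leaf i; GenTree.Leaf j]
  | GNot p => GenTree.Node 2 [:: formula_tree p]
  | GAnd p q => GenTree.Node 3 [:: formula_tree p; formula_tree q]
  | GEx i p => GenTree.Node 4 [:: GenTree.Leaf i; formula_tree p]
  end.

Fixpoint tree_formula (t : GenTree.tree nat) : option gformula :=
  match t with
  | GenTree.Node 0 [:: GenTree.Leaf i; GenTree.Leaf j] => Some (GEq i j)
  | GenTree.Node 1 [:: GenTree.Leaf i; GenTree.Leaf j] => Some (GEdge i j)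
  | GenTree.Node 2 [:: t] => omap GNot (tree_formula t)
  | GenTree.Node 3 [:: t; t'] =>
      if (tree_formula t, tree_formula t') is (Some p, Some q) then Some (GAnd p q) else None
  | GenTree.Node 4 [:: GenTree.Leaf i; t] => omap (GEx i) (tree_formula t)
  | _ => None
  end.

Lemma formula_treeK : pcancel formula_tree tree_formula.
Proof. by elim=> //= [p ->|p -> q ->|i p ->]. Qed.

HB.instance Definition _ := Countable.copy gformula (pcan_type formula_treeK).

Section EmbeddingCodes.

(* A point [y] of the Baire space codes two graphs (through their truth predicates on
   eventually constant assignments [nth d l]), Skolem witnesses for both, and two maps. *)
Notation truth_index := (bool * gformula * nat * seq nat)%type.
Notation index := (truth_index + truth_index + bool * nat)%type.

Definition at_index (y : nat -> nat) (i : index) : nat := y (pickle i).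

Definition truth y g phi d l : bool := at_index y (inl (inl (g, phi, d, l))) != 0.
Definition skolem y g phi d l : nat := at_index y (inl (inr (g, phi, d, l))).
Definition map_of y (e : bool) (a : nat) : nat := at_index y (inr (e, a)).

Definition graph_of y (g : bool) : graph_code :=
  fun p => truth y g (GEdge 0 1) 0 [:: p.1; p.2].

(** The Skolem value replaces the existential quantifier, so that every instance is decided by
    finitely many entries and the set of codes is closed. *)
Definition tarski y g phi d l : Prop :=
  match phi with
  | GEq i j => truth y g phi d l = (nth d l i == nth d l j)
  | GEdge i j => truth y g phi d l = graph_of y g (nth d l i, nth d l j)
  | GNot p => truth y g phi d l = ~~ truth y g p d l
  | GAnd p q => truth y g phi d l = truth y g p d l && truth y g q d l
  | GEx i p =>
      (truth y g phi d l -> truth y g p d (set_nth d l i (skolem y g phi d l))) /\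
      (forall a, truth y g p d (set_nth d l i a) -> truth y g phi d l)
  end.

Definition transfers y (e g : bool) phi d l : Prop :=
  truth y g phi d l = truth y (~~ g) phi (map_of y e d) (map (map_of y e) l).

(** The flag lets one definition serve embeddability and bi-embeddability. *)
Definition codes_embedding (both : bool) : set (nat -> nat) :=
  [set y | [/\ forall g phi d l, tarski y g phi d l,
    forall g, is_graph (graph_of y g),
    forall phi d l, transfers y false false phi d l &
    both -> forall phi d l, transfers y true true phi d l]].

(** Each condition reads finitely many entries of [y], on which [y] agrees with some actual code
    [z]. *)
Lemma codes_embedding_closed both y :
  (forall n, exists2 z, codes_embedding both z & agree n y z) -> codes_embedding both y.
Proof.
move=> lim; have near_ (L : seq index) : exists2 z, codes_embedding both z &
    forall i, i \in L -> at_index y i = at_index z i.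
  have [z Kz yz] := lim (\max_(i <- L) pickle i).+1; exists z => // i iL.
  by apply: yz; rewrite ltnS; apply: leq_bigmax_seq.
pose T g phi d l : index := inl (inl (g, phi, d, l)).
split.
- move=> g [i j|i j|p|p q|i p] d l /=.
  + have [z [/(_ g (GEq i j) d l) H _ _ _] E] := near_ [:: T g (GEq i j) d l].
    by rewrite /truth E ?inE ?eqxx //; apply: H.
  + have [z [/(_ g (GEdge i j) d l) H _ _ _] E] := near_ [:: T g (GEdge i j) d l;
      T g (GEdge 0 1) 0 [:: nth d l i; nth d l j]].
    by rewrite /graph_of /truth !E ?inE ?eqxx ?orbT //; apply: H.
  + have [z [/(_ g (GNot p) d l) H _ _ _] E] := near_ [:: T g (GNot p) d l; T g p d l].
    by rewrite /truth !E ?inE ?eqxx ?orbT //; apply: H.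
  + have [z [/(_ g (GAnd p q) d l) H _ _ _] E] :=
      near_ [:: T g (GAnd p q) d l; T g p d l; T g q d l].
    by rewrite /truth !E ?inE ?eqxx ?orbT //; apply: H.
  + split=> [|a].
      (* The list includes the Skolem entry itself, so that [z] updates [l] in the same way as
         [y]. *)
      have [z [/(_ g (GEx i p) d l) [H _] _ _ _] E] := near_ [:: T g (GEx i p) d l;
        inl (inr (g, GEx i p, d, l)); T g p d (set_nth d l i (skolem y g (GEx i p) d l))].
      have E1 : truth y g (GEx i p) d l = truth z g (GEx i p) d l.
        by rewrite /truth E ?inE ?eqxx.
      have E2 : truth y g p d (set_nth d l i (skolem y g (GEx i p) d l)) =
          truth z g p d (set_nth d l i (skolem y g (GEx i p) d l)).
        by rewrite /truth E ?inE ?eqxx ?orbT.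
      have E3 : skolem y g (GEx i p) d l = skolem z g (GEx i p) d l.
        by apply: E; rewrite !inE eqxx orbT.
      by rewrite E1 E2 E3.
    have [z [/(_ g (GEx i p) d l) [_ /(_ a) H] _ _ _] E] :=
      near_ [:: T g (GEx i p) d l; T g p d (set_nth d l i a)].
    by move: H; rewrite /truth !E ?inE ?eqxx ?orbT.
- move=> g; split=> [i|i j].
    have [z [_ /(_ g) [H _] _ _] E] := near_ [:: T g (GEdge 0 1) 0 [:: i; i]].
    by rewrite /graph_of /truth E ?inE ?eqxx //; apply: H.
  have [z [_ /(_ g) [_ H] _ _] E] :=
    near_ [:: T g (GEdge 0 1) 0 [:: i; j]; T g (GEdge 0 1) 0 [:: j; i]].
  by rewrite /graph_of /truth !E ?inE ?eqxx ?orbT //; apply: H.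
- move=> phi d l.
  have [z [_ _ /(_ phi d l) H _] E] := near_ ([:: T false phi d l;
    T true phi (map_of y false d) (map (map_of y false) l); inr (false, d)] ++
    [seq inr (false, a) | a <- l]).
  move: H; rewrite /transfers /truth /= !E ?inE ?eqxx ?orbT //.
  have -> : map_of y false d = map_of z false d by apply: E; rewrite !inE eqxx ?orbT.
  have -> // : map (map_of y false) l = map (map_of z false) l.
  by apply/eq_in_map => a al; apply: E; rewrite !inE map_f ?orbT.
- move=> bt phi d l.
  have [z [_ _ _ /(_ bt phi d l) H] E] := near_ ([:: T true phi d l;
    T false phi (map_of y true d) (map (map_of y true) l); inr (true, d)] ++
    [seq inr (true, a) | a <- l]).
  move: H; rewrite /transfers /truth /= !E ?inE ?eqxx ?orbT //.
  have -> : map_of y true d = map_of z true d by apply: E; rewrite !inE eqxx ?orbT.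
  have -> // : map (map_of y true) l = map (map_of z true) l.
  by apply/eq_in_map => a al; apply: E; rewrite !inE map_f ?orbT.
Qed.

Lemma nth_set_nthE (d : nat) l i a :
  nth d (set_nth d l i a) = fun k => if k == i then a else nth d l k.
Proof. by apply: funext => k; rewrite nth_set_nth. Qed.

Lemma truth_gsat y g : (forall phi d l, tarski y g phi d l) ->
  forall phi d l, truth y g phi d l <-> gsat (graph_of y g) (nth d l) phi.
Proof.
move=> Ty; elim=> [i j|i j|p IH|p IHp q IHq|i p IH] d l /=.
- by have /= -> := Ty (GEq i j) d l; split=> /eqP.
- by have /= -> := Ty (GEdge i j) d l.
- have /= -> := Ty (GNot p) d l; rewrite -IH.
  by split=> /negP.
- have /= -> := Ty (GAnd p q) d l; rewrite -IHp -IHq.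
  by split=> /andP.
- have /= [T1 T2] := Ty (GEx i p) d l; split=> [/T1|[a]].
    by rewrite IH nth_set_nthE; exists (skolem y g (GEx i p) d l).
  by rewrite -nth_set_nthE -IH => /T2.
Qed.

(** A formula reads only finitely many values of an assignment, so assignments given by lists
    suffice. *)
Lemma transfers_elementary y e g : (forall g phi d l, tarski y g phi d l) ->
  (forall phi d l, transfers y e g phi d l) ->
  elementary_embedding (graph_of y g) (graph_of y (~~ g)) (map_of y e).
Proof.
move=> Ty tr phi s; have [N phiN] := vars_below_exists phi.
pose l := mkseq s N.
rewrite (gsat_ext _ phiN (t := nth 0 l)); last by move=> i iN; rewrite nth_mkseq.
rewrite -truth_gsat // tr truth_gsat //; apply: gsat_ext phiN _ => i iN.
by rewrite (nth_map 0) ?size_mkseq // nth_mkseq.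
Qed.

Lemma codes_embedding_surj (both : bool) (G H : graph_code) h h' :
  is_graph G -> is_graph H -> elementary_embedding G H h ->
  (both -> elementary_embedding H G h') ->
  exists y, [/\ codes_embedding both y, graph_of y false = G & graph_of y true = H].
Proof.
move=> gG gH eh eh'; pose gg (g : bool) := if g then H else G.
have /choice[w wP] (i : truth_index) : exists a,
    let: (g, phi, d, l) := i in
    if phi is GEx k p then gsat (gg g) (nth d l) phi ->
      gsat (gg g) (nth d (set_nth d l k a)) p else True.
  case: i => [[[g phi] d] l]; case: phi => [? ?|? ?|?|? ?|k p]; try by exists 0.
  have [[a pa]|np] := pselect (gsat (gg g) (nth d l) (GEx k p)).
    by exists a => _; rewrite nth_set_nthE.
  by exists 0.
pose val (i : index) : nat := match i with
  | inl (inl (g, phi, d, l)) => `[< gsat (gg g) (nth d l) phi >]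
  | inl (inr i) => w i
  | inr (e, a) => if e then h' a else h a
  end.
pose y n := if @unpickle index n is Some i then val i else 0.
have yE i : at_index y i = val i by rewrite /at_index /y pickleK.
clearbody y.
have TE g phi d l : truth y g phi d l = `[< gsat (gg g) (nth d l) phi >].
  by rewrite /truth yE /=; case: asboolP.
have GE g : graph_of y g = gg g.
  by apply: funext => -[a b]; rewrite /graph_of TE /=; apply: asboolb.
have EE e d l phi g :
    (forall phi s, gsat (gg g) s phi <-> gsat (gg (~~ g)) (map_of y e \o s) phi) ->
    transfers y e g phi d l.
  move=> H1; rewrite /transfers !TE; apply: asbool_equiv_eq; rewrite H1.
  suff -> : map_of y e \o nth d l = nth (map_of y e d) (map (map_of y e) l) by [].
  apply: funext => i /=; have [il|li] := ltnP i (size l); first by rewrite (nth_map d).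
  by rewrite !nth_default ?size_map.
exists y; split; [split|exact: GE|exact: GE].
- move=> g [i j|i j|p|p q|i p] d l /=; rewrite !TE.
  + by apply/asboolP/eqP.
  + by rewrite GE; apply: asboolb.
  + by rewrite asbool_neg.
  + by rewrite asbool_and.
  + split=> [/asboolP H1|a]; last (rewrite TE => /asboolP H1); apply/asboolP.
      by rewrite /skolem yE; apply: (wP (g, GEx i p, d, l)).
    by exists a; move: H1; rewrite nth_set_nthE.
- by move=> g; rewrite GE; case: g.
- move=> phi d l; apply: EE => psi s; rewrite (eh psi s).
  suff -> : map_of y false = h by [].
  by apply: funext => a; rewrite /map_of yE.
- move=> bt phi d l; apply: EE => psi s; rewrite (eh' bt psi s).
  suff -> : map_of y true = h' by [].
  by apply: funext => a; rewrite /map_of yE.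
Qed.

Lemma graph_of_continuous K g :
  continuous (fun y : baire_subspace K => graph_of (sval y) g).
Proof.
move=> y; apply: (@cvg_graph_code ((fun y => graph_of (sval y) g) @ nbhs y)) => p.
pose i : index := inl (inl (g, GEdge 0 1, 0, [:: p.1; p.2])).
apply: filterS (baire_nbhs (pickle i).+1 y) => z yz.
by rewrite /graph_of /truth /at_index /= yz.
Qed.

Lemma codes_embedding_analytic (both : bool) (S : graph_code -> graph_code -> Prop) :
  (forall G H, S G H <-> elem_embeddable G H /\ (both -> elem_embeddable H G)) ->
  analytic (on_graphs S).
Proof.
move=> SE; pose K := codes_embedding both.
exists (baire_subspace K), (fun y => (graph_of (sval y) false, graph_of (sval y) true)).
split.
- exact: baire_polish (@codes_embedding_closed both).
- move=> y; exact: (cvg_pair (@graph_of_continuous K false y) (@graph_of_continuous K true y)).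
apply/seteqP; split=> [_ [[y [Ty gr tr tr']] _ <-]|[G H] /= [gG gH /SE[[h eh] HG]]].
  split=> /=; [exact: gr|exact: gr|apply/SE; split].
    by exists (map_of y false); apply: (transfers_elementary (g := false)).
  by move=> /tr' tr2; exists (map_of y true); apply: (transfers_elementary (g := true)).
(* When only one direction is coded, the second map is arbitrary, here [id]. *)
have [h' eh'] : exists h', both -> elementary_embedding H G h'.
  by case: both HG {K SE} => [/(_ isT)[h' eh']|_]; [exists h'|exists id].
have [y [Ky yG yH]] := codes_embedding_surj gG gH eh eh'.
by exists (exist _ y Ky) => //=; rewrite yG yH.
Qed.

End EmbeddingCodes.

Lemma elem_embeddable_refl G : elem_embeddable G G.
Proof. by exists id. Qed.

Lemma elem_embeddable_trans G H J :
  elem_embeddable G H -> elem_embeddable H J -> elem_embeddable G J.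
Proof. by move=> [h eh] [k ek]; exists (k \o h) => phi s; rewrite eh ek. Qed.

Theorem theorem1p1 :
  (* elementary embeddability on graphs is a Sigma^1_1 quasi-order ... *)
  ((forall G, is_graph G -> elem_embeddable G G) /\
   (forall G H K, is_graph G -> is_graph H -> is_graph K ->
      elem_embeddable G H -> elem_embeddable H K -> elem_embeddable G K) /\
   analytic (on_graphs elem_embeddable)) /\
  (* ... which is complete *)
  (forall (X : topologicalType) (R : X -> X -> Prop),
     polish X -> sigma11_quasi_order R ->
     borel_reducible_to_graphs R elem_embeddable) /\
  (* elementary bi-embeddability on graphs is a Sigma^1_1 equivalence relation ... *)
  ((forall G, is_graph G -> elem_biembeddable G G) /\
   (forall G H, is_graph G -> is_graph H ->
      elem_biembeddable G H -> elem_biembeddable H G) /\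
   (forall G H K, is_graph G -> is_graph H -> is_graph K ->
      elem_biembeddable G H -> elem_biembeddable H K -> elem_biembeddable G K) /\
   analytic (on_graphs elem_biembeddable)) /\
  (* ... which is complete *)
  (forall (X : topologicalType) (R : X -> X -> Prop),
     polish X -> sigma11_equivalence R ->
     borel_reducible_to_graphs R elem_biembeddable).
Proof.
split; [split; [|split]|split; [exact: quasi_order_reduction|split; [split; [|split; [|split]]|]]].
- by move=> G _; apply: elem_embeddable_refl.
- by move=> G H J _ _ _; apply: elem_embeddable_trans.
- by apply: (codes_embedding_analytic (both := false)) => G H; split=> [|[]].
- by move=> G _; split; apply: elem_embeddable_refl.
- by move=> G H _ _ [].
- move=> G H J _ _ _ [GH HG] [HJ JH].
  by split; [apply: elem_embeddable_trans HJ|apply: elem_embeddable_trans HG].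
- apply: (codes_embedding_analytic (both := true)) => G H.
  by split=> [[GH HG]|[GH /(_ isT) HG]]; split.
(* The reduction of [R] as a quasi-order also works here: by symmetry, [R x y] yields embeddings
   both ways. *)
- move=> X R pX [[Rqo Rsym] Ra].
  have [f [bf gf RE]] := quasi_order_reduction pX (conj Rqo Ra).
  exists f; split=> // x y; split=> [Rxy|[/RE]] //.
  by split; apply/RE => //; apply: Rsym.
Qed.
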